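(* Let $G$ be a non-archimedean, Roelcke precompact, Polish group and let $G^\circ$ be the intersection of all open subgroups of finite index in $G$. Then $G$ and $G^\circ$ (the latter with the subspace topology) have Kazhdan's property (T), and $G^\circ$ has a finite Kazhdan set (that is, there are a finite set $Q \subseteq G^\circ$ and $\varepsilon > 0$ such that $(Q,\varepsilon)$ is a Kazhdan pair for $G^\circ$).
   Context: A topological group is non-archimedean if it has a base of open neighbourhoods of the identity consisting of subgroups. A topological group $G$ is Roelcke precompact if for every open neighbourhood $U$ of the identity there is a finite set $E \subseteq G$ with $G = UEU$. A unitary representation of a topological group $G$ is a homomorphism $\pi \colon G \to U(\mathcal{H})$ to the unitary group of a Hilbert space $\mathcal{H}$ such that for every $\xi \in \mathcal{H}$ the map $g \mapsto \pi(g)\xi$ is continuous. For $Q \subseteq G$ and $\varepsilon > 0$, a non-zero vector $\xi \in \mathcal{H}$ is $(Q,\varepsilon)$-invariant for $\pi$ if $\sup_{x \in Q} \|\pi(x)\xi - \xi\| < \varepsilon \|\xi\|$. The pair $(Q,\varepsilon)$ is a Kazhdan pair for $G$ if every unitary representation $\pi$ of $G$ that has a $(Q,\varepsilon)$-invariant vector has a non-zero $G$-invariant vector. The group $G$ has Kazhdan's property (T) if there is a Kazhdan pair $(Q,\varepsilon)$ with $Q$ compact. *)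

(* Defs.v *)
From HB Require Import structures.
From mathcomp Require Import all_boot all_order all_algebra.
From mathcomp Require Import sesquilinear complex.
From mathcomp Require Import all_classical all_reals all_analysis.

Set Implicit Arguments.
Unset Strict Implicit.
Unset Printing Implicit Defensive.

Import Order.TTheory GRing.Theory Num.Theory.
Import numFieldNormedType.Exports.

Local Open Scope classical_set_scope.
Local Open Scope ring_scope.

HB.mixin Record isTopologicalGroup G & Topological G & Group G := {
  mulg_continuous : continuous (fun x : G * G => (x.1 * x.2)%g) ;
  invg_continuous : continuous (fun x : G => (x^-1)%g) ;
}.

#[short(type="topologicalGroupType")]
HB.structure Definition TopologicalGroup :=
  {G of Topological G & Group G & isTopologicalGroup G}.

Section SubgroupType.
Variables (G : topologicalGroupType) (K : set G).

(* A subgroup as a group in its own right.  The proof of closedness is a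
   parameter of the type only so that the group structure can be inferred. *)
Definition subgroup_type (_ : group_closed [in K]) : Type := set_type K.

Variable gK : group_closed [in K].

(* Unfolds to the initial topology of the inclusion, i.e. the subspace
   topology. *)
HB.instance Definition _ :=
  Topological.copy (subgroup_type gK) (set_type K).
HB.instance Definition _ := SubChoice.copy (subgroup_type gK) (set_type K).
HB.instance Definition _ :=
  SubChoice_isSubGroup.Build G [in K] (subgroup_type gK) gK.

Lemma subgroup_val_continuous : continuous (val : subgroup_type gK -> G).
Proof. exact: (@initial_continuous (set_type K) G set_val). Qed.

Lemma subgroup_continuous (T : topologicalType) (f : T -> subgroup_type gK) :
  continuous (val \o f) -> continuous f.
Proof.
move=> /continuousP cf; apply/continuousP => _ [A oA <-].
exact: (cf A oA).
Qed.

Lemma subgroup_mulg_continuous :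
  continuous (fun x : subgroup_type gK * subgroup_type gK => (x.1 * x.2)%g).
Proof.
apply: subgroup_continuous => x.
rewrite (_ : _ \o _ = (fun y : G * G => (y.1 * y.2)%g) \o
   (fun x : subgroup_type gK * subgroup_type gK => (val x.1, val x.2))) //.
apply: continuous_comp; last exact: mulg_continuous.
apply: cvg_pair; apply: continuous_comp;
  by [exact: cvg_fst | exact: cvg_snd | exact: subgroup_val_continuous].
Qed.

Lemma subgroup_invg_continuous :
  continuous (fun x : subgroup_type gK => (x^-1)%g).
Proof.
apply: subgroup_continuous => x.
rewrite (_ : _ \o _ = (fun y : G => (y^-1)%g) \o val); last first.
  by apply/funext => y.
apply: continuous_comp; last exact: invg_continuous.
exact: subgroup_val_continuous.
Qed.

HB.instance Definition _ := isTopologicalGroup.Build (subgroup_type gK)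
  subgroup_mulg_continuous subgroup_invg_continuous.

End SubgroupType.

Section Groups.
Variable G : topologicalGroupType.

Definition non_archimedean :=
  forall U : set G, open_nbhs 1%g U ->
    exists V : set G, [/\ open V, group_closed [in V] & V `<=` U].

Definition roelcke_precompact :=
  forall U : set G, open_nbhs 1%g U -> exists2 E : set G, finite_set E &
    forall g, exists u e v, [/\ U u, E e, U v & g = (u * e * v)%g].

Definition finite_index (V : set G) :=
  finite_set [set [set (g * v)%g | v in V] | g in [set: G]].

Definition open_finite_index_subgroup (V : set G) :=
  [/\ open V, group_closed [in V] & finite_index V].

Definition finite_index_core : set G :=
  \bigcap_(V in [set V | open_finite_index_subgroup V]) V.

Lemma finite_index_core_closed : group_closed [in finite_index_core].
Proof.
split; first by rewrite inE => V [_ [V1 _] _]; rewrite -in_setE.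
move=> x y; rewrite !inE => xK yK V oV; rewrite -in_setE.
have [_ [_ Vd] _] := oV.
by apply: Vd; rewrite in_setE; [exact: xK | exact: yK].
Qed.

End Groups.

(* G°, the intersection of all open finite-index subgroups of G. *)
Definition finite_index_core_group (G : topologicalGroupType) :
  topologicalGroupType := subgroup_type (@finite_index_core_closed G).

Section Polish.
Variables (R : realType) (T : topologicalType).

Definition is_metric (d : T -> T -> R) :=
  [/\ forall x y, (d x y = 0) <-> (x = y),
      forall x y, d x y = d y x &
      forall x y z, d x z <= d x y + d y z].

Definition metric_induces_topology (d : T -> T -> R) :=
  forall x (A : set T),
    nbhs x A <-> exists2 e : R, 0 < e & [set y | d x y < e] `<=` A.

Definition complete_metric (d : T -> T -> R) :=
  forall u : nat -> T,
    (forall e : R, 0 < e -> exists N, forall m n : nat,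
        (N <= m)%N -> (N <= n)%N -> d (u m) (u n) < e) ->
    exists l : T, u @ \oo --> l.

Definition polish :=
  (exists2 D : set T, countable D & dense D) /\
  exists d : T -> T -> R,
    [/\ is_metric d, metric_induces_topology d & complete_metric d].

End Polish.

(* A complex Hilbert space: a complete normed space over R[i] whose norm comes
   from an inner product (linear in the first variable).  Norms of vectors are
   elements of R[i] here. *)
Record hilbertSpace (R : realType) := HilbertSpace {
  hilbert_sort :> completeNormedModType R[i];
  hdot : {dot hilbert_sort for (@Num.conj R[i])};
  hdotE : forall x : hilbert_sort, hdot x x = `|x| ^+ 2
}.

Definition hnorm (R : realType) (H : hilbertSpace R) (x : H) : R :=
  complex.Re `|x|.

Definition unitary_operator (R : realType) (H : hilbertSpace R) (u : H -> H) :=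
  [/\ linear u, bijective u & forall x y, hdot H (u x) (u y) = hdot H x y].

Section Kazhdan.
Variables (R : realType) (G : topologicalGroupType).

Definition unitary_representation (H : hilbertSpace R) (pi : G -> H -> H) :=
  [/\ forall g, unitary_operator (pi g),
      forall g h, pi (g * h)%g = pi g \o pi h &
      forall x : H, continuous (fun g => pi g x)].

(* The supremum is taken in the extended reals; for Q = set0 it is -oo, so that
   the condition then holds for every non-zero vector. *)
Definition almost_invariant (H : hilbertSpace R) (pi : G -> H -> H)
    (Q : set G) (eps : R) (x : H) :=
  x != 0 /\
  (ereal_sup [set (hnorm (pi g x - x))%:E | g in Q] < (eps * hnorm x)%:E)%E.

Definition kazhdan_pair (Q : set G) (eps : R) :=
  0 < eps /\
  forall (H : hilbertSpace R) (pi : G -> H -> H),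
    unitary_representation pi ->
    (exists x, almost_invariant pi Q eps x) ->
    exists2 x : H, x != 0 & forall g, pi g x = x.

Definition property_T :=
  exists (Q : set G) (eps : R), compact Q /\ kazhdan_pair Q eps.

Definition finite_kazhdan_set :=
  exists (Q : set G) (eps : R), finite_set Q /\ kazhdan_pair Q eps.

End Kazhdan.

(* Main.v *)
Require Import Defs.
From HB Require Import structures.
From mathcomp Require Import all_boot all_order all_algebra.
From mathcomp Require Import sesquilinear complex.
From mathcomp Require Import all_classical all_reals all_analysis.
From mathcomp Require Import ring lra zify.
Set Implicit Arguments.
Unset Strict Implicit.
Unset Printing Implicit Defensive.

Import Order.TTheory GRing.Theory Num.Theory.
Import numFieldNormedType.Exports.

Local Open Scope classical_set_scope.
Local Open Scope ring_scope.

(** The proof for a group G without proper open subgroups of finite index rests on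
    two elements a and b, found once and for all, with
      |x|^2 <= 6 (|a x - x|^2 + |b x - x|^2)
    for all vectors x orthogonal to the invariants, in all representations
    ([spectral_gap]).  Write H(U) for the closure of the space of vectors with a
    finite orbit under the open subgroup U.  The elements a and b are limits of a
    back-and-forth construction ([free_pair]).  At each stage a is known on H(V)
    for some open V, with image H(a V a^-1), and everything seen so far lies in H(S)
    for some open S.  When the domain grows from H(V) to H(V'), the new part of
    H(V') is sent into the orthogonal complement of H(S); when the range grows, the
    same is done for a^-1.  A unit vector x orthogonal to the invariants is the
    orthogonal sum of its components in these new parts.  If a almost fixes x then
    nearly all the mass of x is found in the increments of H(S) made by the steps
    for a; likewise for b.  These increments are orthogonal for a and b, so both
    cannot hold.  It is the ping-pong argument for a free group acting freely,
    carried out directly with projections.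

    New parts can be moved off H(S) by [independence]: for open subgroups C and D of
    V some v in V makes v E orthogonal to H(D), where E is the part of H(C)
    orthogonal to H(V), in all representations at once.  This comes from
    [weak_mixing], for finite families of vectors in a direct sum, because there
    are finitely many double cosets D v C.  Weak mixing itself ([weak_mixing1]) is
    proved by minimisation.  For x fixed by an open subgroup the weak closure of V x
    contains a vector z of least norm, since only finitely many norms occur there.
    No weak limit of the orbit of z is shorter than z, so weak and norm convergence
    agree on that orbit, the orbit is precompact and z lies in H(V).  If x is
    orthogonal to H(V) this forces z = 0.

    For a general G let K be the intersection of its open subgroups of finite index.
    Three facts reduce everything to the case above: K is Roelcke precompact
    ([core_roelcke]), K has no proper open subgroup of finite index ([core_no_finite_index_subgroup]),
    and G = C K for some compact C ([core_compact_lift]).  They follow from the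
    fact that K W has finite index for every open subgroup W ([core_product]).  The
    gap then gives a finite Kazhdan set of K, and its union with C is a Kazhdan set
    of G: a vector almost invariant under both is close to a vector fixed by K, whose
    G-orbit equals its C-orbit and stays close to it.

    The complete metric of G is not invariant, so Cauchy sequences of G do not
    converge for free.  All limits are obtained from one construction
    ([uniform_zigzag]), in which two sequences are built alternately and the element
    sought is a quotient of their limits. *)

Lemma inv_small (R : realType) (e : R) : 0 < e ->
  exists N, forall n, (N <= n)%N -> n.+1%:R^-1 < e.
Proof.
move=> e0; have [N hN] := ltr_add_invr e0.
rewrite add0r in hN; exists N => n Nn; apply: le_lt_trans hN.
by rewrite lef_pV2 ?posrE ?ltr0Sn // ler_nat.
Qed.

(** * Real Hilbert spaces *)

(** A unitary representation is only ever used through the real part of its inner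
    product, so the whole argument takes place in real Hilbert spaces.  A bare
    record makes direct sums easy to form. *)

Record real_hilbert (R : realType) := RealHilbert {
  rh_carrier :> lmodType R;
  ip : rh_carrier -> rh_carrier -> R;
  ipC : forall x y, ip x y = ip y x;
  ipDl : forall x y z, ip (x + y) z = ip x z + ip y z;
  ipZl : forall r x y, ip (r *: x) y = r * ip x y;
  ip_ge0 : forall x, 0 <= ip x x;
  ip_eq0 : forall x, ip x x = 0 -> x = 0;
  ip_complete : forall u : nat -> rh_carrier,
    (forall e, 0 < e -> exists N, forall m n, (N <= m)%N -> (N <= n)%N ->
       ip (u m - u n) (u m - u n) < e) ->
    exists l, forall e, 0 < e -> exists N, forall n, (N <= n)%N ->
       ip (u n - l) (u n - l) < e }.

Section Hilbert.
Variables (R : realType) (H : real_hilbert R).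
Implicit Types (x y z : H) (K M : set H) (e r t : R).

(** The squared norm; working with squares avoids all square roots. *)
Definition q x : R := ip x x.

Lemma ipDr x y z : ip x (y + z) = ip x y + ip x z.
Proof. by rewrite ipC ipDl !(ipC x). Qed.
Lemma ipZr r x y : ip x (r *: y) = r * ip x y.
Proof. by rewrite ipC ipZl ipC. Qed.
Lemma ipNl x y : ip (- x) y = - ip x y.
Proof. by rewrite -scaleN1r ipZl mulN1r. Qed.
Lemma ipNr x y : ip x (- y) = - ip x y.
Proof. by rewrite ipC ipNl ipC. Qed.
Lemma ipBl x y z : ip (x - y) z = ip x z - ip y z.
Proof. by rewrite ipDl ipNl. Qed.
Lemma ipBr x y z : ip x (y - z) = ip x y - ip x z.
Proof. by rewrite ipDr ipNr. Qed.
Lemma ip0l x : ip 0 x = 0.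
Proof. by rewrite -(subrr x) ipBl subrr. Qed.
Lemma ip0r x : ip x 0 = 0.
Proof. by rewrite ipC ip0l. Qed.

Lemma q_ge0 x : 0 <= q x. Proof. exact: ip_ge0. Qed.
Lemma q0 : q 0 = 0. Proof. exact: ip0l. Qed.
Lemma q_eq0 x : q x = 0 -> x = 0. Proof. exact: ip_eq0. Qed.
Lemma qD x y : q (x + y) = q x + 2 * ip x y + q y.
Proof. by rewrite /q ipDl !ipDr (ipC y x); ring. Qed.
Lemma qN x : q (- x) = q x.
Proof. by rewrite /q ipNl ipNr opprK. Qed.
Lemma qB x y : q (x - y) = q x - 2 * ip x y + q y.
Proof. by rewrite qD ipNr qN; ring. Qed.
Lemma qBC x y : q (x - y) = q (y - x).
Proof. by rewrite -qN opprB. Qed.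
Lemma qZ r x : q (r *: x) = r ^+ 2 * q x.
Proof. by rewrite /q ipZl ipZr; ring. Qed.
Lemma q_tri x y z : q (x - z) <= 2 * q (x - y) + 2 * q (y - z).
Proof.
have -> : x - z = (x - y) + (y - z) by rewrite addrA subrK.
have := q_ge0 ((x - y) - (y - z)).
rewrite (qB (x - y)) (qD (x - y)); lra.
Qed.
Lemma q_gt0 x : x != 0 -> 0 < q x.
Proof.
by move=> x0; rewrite lt_neqAle q_ge0 andbT eq_sym;
  apply: contraNneq x0 => /q_eq0 ->.
Qed.

Lemma cauchy_schwarz x y : ip x y ^+ 2 <= q x * q y.
Proof.
have [->|y0] := eqVneq y 0; first by rewrite ip0r q0 mulr0 expr0n.
have qy := q_gt0 y0.
have := q_ge0 (q y *: x - ip x y *: y).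
rewrite qB !qZ ipZl ipZr => h.
have {}h : 0 <= q y * (q x * q y - ip x y ^+ 2) by apply: le_trans h _; lra.
by rewrite pmulr_rge0 // subr_ge0 in h.
Qed.

Lemma q_le_ip x y : q x = ip x y -> q x <= q y.
Proof. by move=> h; have := q_ge0 (x - y); rewrite qB -h; lra. Qed.

Definition clos K : set H :=
  [set x | forall e, 0 < e -> exists2 k, K k & q (x - k) < e].
Definition qclosed K := clos K `<=` K.
Definition convex K := forall x y t, K x -> K y -> 0 <= t <= 1 ->
  K (t *: x + (1 - t) *: y).
Definition subspace M := [/\ M 0, (forall x y, M x -> M y -> M (x + y)) &
  forall r x, M x -> M (r *: x)].

Lemma sub_clos K : K `<=` clos K.
Proof. by move=> x Kx e e0; exists x => //; rewrite subrr q0. Qed.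

Lemma clos_sub K K' : K `<=` K' -> clos K `<=` clos K'.
Proof. by move=> KK x Kx e /Kx[k /KK]; exists k. Qed.

Lemma qclosed_clos K : qclosed (clos K).
Proof.
move=> x Kx e e0; have e4 : 0 < e / 4 by lra.
have [y Ky xy] := Kx _ e4; have [k Kk yk] := Ky _ e4.
by exists k => //; have := q_tri x y k; lra.
Qed.

Lemma subspace_convex M : subspace M -> convex M.
Proof. by case=> _ MD MZ x y t Mx My _; apply: MD; apply: MZ. Qed.

Lemma subspaceB M x y : subspace M -> M x -> M y -> M (x - y).
Proof.
by case=> _ MD MZ Mx My; apply: MD => //; rewrite -scaleN1r; apply: MZ.
Qed.

Lemma clos_subspace M : subspace M -> subspace (clos M).
Proof.
move=> [M0 MD MZ]; split; first exact: sub_clos.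
- move=> x y Mx My e e0; have e4 : 0 < e / 4 by lra.
  have [k Kk xk] := Mx _ e4; have [l Kl yl] := My _ e4.
  exists (k + l); first exact: MD.
  have -> : x + y - (k + l) = (x - k) - - (y - l).
    by rewrite opprK opprD addrACA.
  by have := q_tri (x - k) 0 (- (y - l)); rewrite subr0 sub0r opprK; lra.
- move=> r x Mx e e0; have r0 : 0 < r ^+ 2 + 1 by have := sqr_ge0 r; lra.
  have [k Kk xk] := Mx (e / (r ^+ 2 + 1)) (divr_gt0 e0 r0).
  exists (r *: k); first exact: MZ.
  rewrite -scalerBr qZ; move: xk; rewrite ltr_pdivlMr // => xk.
  by have := q_ge0 (x - k); lra.
Qed.

Lemma sub_subB x y z : z - y = (x - y) - (x - z).
Proof. by rewrite opprB [RHS]addrC addrA subrK. Qed.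

Lemma midpointB x y z :
  x - (2^-1 *: y + (1 - 2^-1) *: z) = 2^-1 *: ((x - y) + (x - z)).
Proof.
have -> : 1 - 2^-1 = 2^-1 :> R by lra.
rewrite -scalerDr addrACA -opprD -mulr2n [RHS]scalerBr -[x *+ 2]scaler_nat.
by rewrite scalerA mulVf ?pnatr_eq0 // scale1r.
Qed.

(** The norm is strictly convex, so a minimising sequence is Cauchy by the
    parallelogram law. *)
Lemma nearest_point K x : qclosed K -> convex K -> K !=set0 ->
  exists2 y, K y & forall k, K k -> q (x - y) <= q (x - k).
Proof.
move=> Kcl Kcv [k0 Kk0].
pose S := [set q (x - k) | k in K].
have hS : has_inf S.
  split; first by exists (q (x - k0)), k0.
  by exists 0 => _ [k _ <-]; exact: q_ge0.
pose d := inf S.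
have dle k : K k -> d <= q (x - k).
  by move=> Kk; apply: ge_inf; [exact: hS.2 | exists k].
have dap e : 0 < e -> exists2 k, K k & q (x - k) < d + e.
  move=> e0; have [_ [k Kk <-] kd] := inf_adherent e0 hS.
  by exists k.
have [u uP] : exists u : nat -> H, forall n, K (u n) /\
     q (x - u n) < d + n.+1%:R^-1.
  have [n|u uP] := @boolp.choice nat H
    (fun n k => K k /\ q (x - k) < d + n.+1%:R^-1); last by exists u.
  have n0 : 0 < n.+1%:R^-1 :> R by rewrite invr_gt0 ltr0Sn.
  by have [k Kk kd] := dap _ n0; exists k.
have mid k l : K k -> K l -> q (k - l) <= 2 * (q (x - k) - d) + 2 * (q (x - l) - d).
  move=> Kk Kl.
  have half : 0 <= (2^-1 : R) <= 1 by apply/andP; split; lra.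
  have := dle _ (Kcv _ _ _ Kk Kl half).
  have -> : x - (2^-1 *: k + (1 - 2^-1) *: l) = 2^-1 *: ((x - k) + (x - l)).
    exact: midpointB.
  rewrite qZ (qD (x - k)) => h1.
  have -> : k - l = (x - l) - (x - k).
    exact: sub_subB.
  rewrite qB (ipC (x - l)); move: h1.
  have -> : (2^-1 : R) ^+ 2 = 4^-1 by rewrite exprVn -natrX.
  lra.
have [y yP] : exists l, forall e, 0 < e -> exists N, forall n, (N <= n)%N ->
       q (u n - l) < e.
  apply: ip_complete => e e0; have [|N hN] := @inv_small R (e / 4); first by lra.
  exists N => m n /hN hm /hN hn.
  have [Km qm] := uP m; have [Kn qn] := uP n.
  have h := mid _ _ Km Kn; apply: le_lt_trans h _.
  by move: qm qn hm hn; set i := m.+1%:R^-1; set j := n.+1%:R^-1; lra.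
exists y.
  apply: Kcl => e e0; have [N hN] := yP e e0; exists (u N); first exact: (uP N).1.
  by rewrite qBC; exact: hN.
move=> k Kk.
(* The weighted triangle inequality q (a + b) <= (1 + e) q a + (1 + 1/e) q b. *)
suff h e : 0 < e -> q (x - y) <= (1 + e) * (d + e) + (1 + e^-1) * e ^+ 2.
  apply: le_trans (dle _ Kk).
  apply/ler_addgt0Pr => e e0.
  have d0 : 0 <= d by apply: lb_le_inf hS.1 _ => _ [l _ <-]; exact: q_ge0.
  (* Small enough for (1 + f) (d + f) + (1 + 1/f) f ^ 2 <= d + e. *)
  pose f := Num.min 1 (e / (d + 4)).
  have f0 : 0 < f by rewrite lt_min ltr01 divr_gt0 //; lra.
  have f1 : f <= 1 by rewrite ge_min lexx.
  have fe : f * (d + 4) <= e.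
    by rewrite -ler_pdivlMr ?ge_min ?lexx ?orbT //; lra.
  apply: le_trans (h f f0) _.
  have -> : (1 + f^-1) * f ^+ 2 = f ^+ 2 + f by field; lra.
  have ff : f ^+ 2 <= f by rewrite expr2 -{3}(mulr1 f) ler_wpM2l // ltW.
  by lra.
move=> e0; have e2 : 0 < e ^+ 2 by rewrite exprn_gt0.
have [N hN] := yP _ e2; have [N' hN'] := inv_small e0.
pose n := maxn N N'.
have h1 := hN n (leq_maxl _ _); have h2 := hN' n (leq_maxr _ _).
have h3 := lt_trans (uP n).2 (etrans (ltrD2l d _ _) h2).
have -> : x - y = (x - u n) + (u n - y) by rewrite addrA subrK.
set a := x - u n in h3 *; set b := u n - y in h1 *.
have : q (a + b) <= (1 + e) * q a + (1 + e^-1) * q b.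
  have := q_ge0 (e *: a - b); rewrite qB qZ ipZl qD => h.
  have : 0 <= e^-1 * (e ^+ 2 * q a - 2 * (e * ip a b) + q b).
    by apply: mulr_ge0 => //; rewrite invr_ge0 ltW.
  have -> : e^-1 * (e ^+ 2 * q a - 2 * (e * ip a b) + q b)
            = e * q a - 2 * ip a b + e^-1 * q b by field; lra.
  lra.
have : (1 + e) * q a <= (1 + e) * (d + e) by apply: ler_wpM2l; lra.
have : (1 + e^-1) * q b <= (1 + e^-1) * e ^+ 2.
  by apply: ler_wpM2l; [have : 0 < e^-1 by rewrite invr_gt0 | ]; lra.
lra.
Qed.

Lemma nearest_point_unique K x y z : convex K -> K y -> K z ->
  (forall k, K k -> q (x - y) <= q (x - k)) ->
  q (x - z) <= q (x - y) -> z = y.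
Proof.
move=> Kcv Ky Kz hy hz; apply/eqP; rewrite -subr_eq0; apply/eqP/q_eq0.
apply/eqP; rewrite eq_le q_ge0 andbT.
have half : 0 <= (2^-1 : R) <= 1 by apply/andP; split; lra.
have := hy _ (Kcv _ _ _ Ky Kz half).
have -> : x - (2^-1 *: y + (1 - 2^-1) *: z) = 2^-1 *: ((x - y) + (x - z)).
  exact: midpointB.
rewrite qZ (qD (x - y)) => h1.
rewrite (sub_subB x y z).
rewrite qB; move: h1.
have -> : (2^-1 : R) ^+ 2 = 4^-1 by rewrite exprVn -natrX.
lra.
Qed.

(** ** Orthogonal projection on the closure of a subspace *)

(** The nearest point of the closure works: moving along a vector m of M cannot
    decrease the distance, so the first-order term vanishes. *)
Lemma proj_exists M x : subspace M ->
  exists y, clos M y /\ forall m, M m -> ip (x - y) m = 0.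
Proof.
move=> Ms; have cMs := clos_subspace Ms.
have [y cy ymin] := @nearest_point (clos M) x (@qclosed_clos M)
  (subspace_convex cMs) (ex_intro _ 0 (sub_clos (let: And3 h _ _ := Ms in h))).
exists y; split=> // m Mm; set c := ip (x - y) m.
have h t : 0 <= t ^+ 2 * q m - 2 * t * c.
  have /ymin : clos M (y + t *: m).
    by case: cMs => _ cD cZ; apply: cD => //; apply/cZ/sub_clos.
  by rewrite opprD addrA (qB (x - y)) qZ ipZr -/c; lra.
apply/eqP/negPn/negP => c0.
have c2 : 0 < c ^+ 2 by rewrite exprn_even_gt0.
have qm := q_ge0 m.
have q1 : 0 < q m + 1 by lra.
have := h (c / (q m + 1)).
have -> : (c / (q m + 1)) ^+ 2 * q m - 2 * (c / (q m + 1)) * c =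
   - (c ^+ 2 * (q m + 2)) / (q m + 1) ^+ 2 by field; lra.
rewrite leNgt => /negP; apply.
rewrite pmulr_llt0 ?invr_gt0 ?exprn_gt0 // oppr_lt0 mulr_gt0 //; lra.
Qed.

Definition oproj M x : H := xget 0 [set y | clos M y /\
  forall m, M m -> ip (x - y) m = 0].

Lemma projP M x : subspace M -> clos M (oproj M x) /\
  forall m, M m -> ip (x - oproj M x) m = 0.
Proof.
by move=> /(@proj_exists _ x)[y yP]; rewrite /oproj; case: xgetP => [z ->//|/(_ y)].
Qed.

Lemma orth_clos M x y : (forall m, M m -> ip x m = 0) -> clos M y -> ip x y = 0.
Proof.
move=> xM cy; apply/eqP; rewrite -sqrf_eq0 eq_le sqr_ge0 andbT.
apply/ler_addgt0Pr => e e0; rewrite add0r.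
have q1 : 0 < q x + 1 by have := q_ge0 x; lra.
have [k Mk yk] := cy (e / (q x + 1)) (divr_gt0 e0 q1).
have -> : ip x y = ip x (y - k) by rewrite ipBr (xM k) // subr0.
apply: le_trans (cauchy_schwarz _ _) _.
move: yk; rewrite ltr_pdivlMr // => yk.
by have := q_ge0 (y - k); lra.
Qed.

Lemma proj_clos M x : subspace M -> clos M (oproj M x).
Proof. by case/(@projP _ x). Qed.

Lemma proj_orth M x y : subspace M -> clos M y -> ip (x - oproj M x) y = 0.
Proof. by case/(@projP _ x) => _; exact: orth_clos. Qed.

Lemma proj_unique M x y : subspace M -> clos M y ->
  (forall m, M m -> ip (x - y) m = 0) -> oproj M x = y.
Proof.
move=> Ms cy yo; have [cp po] := projP x Ms.
apply/eqP; rewrite -subr_eq0; apply/eqP/q_eq0; rewrite /q.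
have cpy := subspaceB (clos_subspace Ms) cp cy.
have -> : ip (oproj M x - y) (oproj M x - y) =
  ip (x - y) (oproj M x - y) - ip (x - oproj M x) (oproj M x - y).
  by rewrite -ipBl -sub_subB.
by rewrite (orth_clos yo) // (orth_clos po) // subrr.
Qed.

Lemma proj_ip M x y : subspace M -> clos M y -> ip y (oproj M x) = ip y x.
Proof.
move=> Ms cy; have := proj_orth x Ms cy.
by rewrite ipBl (ipC y) (ipC y x); lra.
Qed.

Lemma proj_id M x : subspace M -> clos M x -> oproj M x = x.
Proof. by move=> Ms cx; apply: proj_unique => // m _; rewrite subrr ip0l. Qed.

Lemma projD M x y : subspace M -> oproj M (x + y) = oproj M x + oproj M y.
Proof.
move=> Ms; apply: proj_unique => //.
  by case: (clos_subspace Ms) => _ + _; apply; exact: proj_clos.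
by move=> m /sub_clos Mm; rewrite opprD addrACA ipDl !proj_orth // addr0.
Qed.

Lemma projZ M r x : subspace M -> oproj M (r *: x) = r *: oproj M x.
Proof.
move=> Ms; apply: proj_unique => //.
  by case: (clos_subspace Ms) => _ _; apply; exact: proj_clos.
by move=> m /sub_clos Mm; rewrite -scalerBr ipZl proj_orth // mulr0.
Qed.

Lemma projB M x y : subspace M -> oproj M (x - y) = oproj M x - oproj M y.
Proof. by move=> Ms; rewrite projD // -scaleN1r projZ // scaleN1r. Qed.

Lemma q_proj M x : subspace M -> q (oproj M x) = ip (oproj M x) x.
Proof. by move=> Ms; apply: proj_ip => //; exact: proj_clos. Qed.

Lemma q_proj_le M x : subspace M -> q (oproj M x) <= q x.
Proof. by move=> Ms; apply: q_le_ip; exact: q_proj. Qed.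

Lemma q_sub_proj M x : subspace M -> q (x - oproj M x) = q x - q (oproj M x).
Proof. by move=> Ms; rewrite qB ipC -q_proj //; lra. Qed.

Lemma proj_sub M N x : subspace M -> subspace N -> M `<=` N ->
  oproj M (oproj N x) = oproj M x.
Proof.
move=> Ms Ns MN; apply: proj_unique => //; first exact: proj_clos.
move=> m Mm.
have -> : oproj N x - oproj M x = (x - oproj M x) - (x - oproj N x).
  exact: sub_subB.
by rewrite ipBl !proj_orth ?subrr //; apply: sub_clos => //; exact: MN.
Qed.

(** ** The Riesz representation theorem *)

(** Up to scale, the vector representing f is the component of any vector off the
    kernel that is orthogonal to the kernel. *)
Lemma riesz (f : H -> R) (B : R) :
  (forall x y, f (x + y) = f x + f y) -> (forall r x, f (r *: x) = r * f x) ->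
  (forall x, f x ^+ 2 <= B * q x) -> exists z, forall y, f y = ip z y.
Proof.
move=> fD fZ fB.
have fN x y : f (x - y) = f x - f y by rewrite fD -scaleN1r fZ mulN1r.
pose M := [set x | f x = 0].
have Ms : subspace M.
  split; rewrite /M /=; first by rewrite -(scale0r 0) fZ mul0r.
    by move=> x y fx fy; rewrite fD fx fy addr0.
  by move=> r x fx; rewrite fZ fx mulr0.
have Mcl : qclosed M.
  move=> x cx; apply/eqP; rewrite -sqrf_eq0 eq_le sqr_ge0 andbT.
  apply/ler_addgt0Pr => e e0; rewrite add0r.
  have B1 : 0 < `|B| + 1 by have := normr_ge0 B; lra.
  have [k Mk xk] := cx (e / (`|B| + 1)) (divr_gt0 e0 B1).
  have -> : f x = f (x - k) by rewrite fN Mk subr0.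
  apply: le_trans (fB _) _; move: xk; rewrite ltr_pdivlMr // => xk.
  have := ler_norm B; have := q_ge0 (x - k) => h1 h2.
  by have := ler_wpM2r h1 h2; lra.
have [f0|] := pselect (forall x, f x = 0).
  by exists 0 => y; rewrite ip0l.
move=> /existsNP[x /eqP fx]; pose u := x - oproj M x.
have fu : f u != 0.
  by rewrite fN (_ : f (oproj M x) = 0) ?subr0 //; apply: Mcl; exact: proj_clos.
have qu : 0 < q u.
  apply: q_gt0; apply: contraNneq fu => ->.
  by rewrite -(scale0r 0) fZ mul0r.
exists ((f u / q u) *: u) => y.
have My : M (y - (f y / f u) *: u).
  by rewrite /M /= fN fZ divfK // subrr.
have := proj_orth x Ms (sub_clos My).
rewrite -/u ipBr ipZr -/(q u) ipZl => /eqP; rewrite subr_eq0 => /eqP ->.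
by field; rewrite fu gt_eqF.
Qed.

End Hilbert.

(** * Open subgroups *)

Section OpenSubgroups.
Variable G : topologicalGroupType.
Implicit Types (A B L U V : set G) (g h x y : G).

Definition open_subgroup A := open A /\ group_closed [in A].

Lemma group_closedP A :
  group_closed [in A] <-> A 1%g /\ forall x y, A x -> A y -> A (x / y)%g.
Proof.
split=> [[A1 AD]|[A1 AD]]; split.
- by rewrite -in_setE.
- by move=> x y Ax Ay; rewrite -in_setE; apply: AD; rewrite in_setE.
- by rewrite in_setE.
- by move=> x y; rewrite !in_setE; exact: AD.
Qed.

Lemma osub1 A : open_subgroup A -> A 1%g.
Proof. by case=> _ /group_closedP[]. Qed.

Lemma osubF A x y : open_subgroup A -> A x -> A y -> A (x / y)%g.
Proof. by case=> _ /group_closedP[_]; apply. Qed.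

Lemma osubV A x : open_subgroup A -> A x -> A (x^-1)%g.
Proof. by move=> sA Ax; rewrite -div1g; apply: osubF => //; exact: osub1. Qed.

Lemma osubM A x y : open_subgroup A -> A x -> A y -> A (x * y)%g.
Proof.
by move=> sA Ax Ay; rewrite -(invgK y); apply: osubF => //; exact: osubV.
Qed.

Lemma osubT : open_subgroup [set: G].
Proof. by split; [exact: openT | apply/group_closedP]. Qed.

Lemma osubI A B : open_subgroup A -> open_subgroup B -> open_subgroup (A `&` B).
Proof.
move=> sA sB; split; first by apply: openI; [case: sA | case: sB].
apply/group_closedP; split; first by split; exact: osub1.
by move=> x y [? ?] [? ?]; split; exact: osubF.
Qed.

Lemma mulgl_continuous g : continuous (fun x : G => g * x)%g.
Proof.
move=> x; apply: (@continuous_comp _ _ _ (fun x => (g, x)) (fun z => z.1 * z.2)%g).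
  by apply: cvg_pair => /=; [exact: cvg_cst | exact: cvg_id].
exact: mulg_continuous.
Qed.

Lemma mulgr_continuous g : continuous (fun x : G => x * g)%g.
Proof.
move=> x; apply: (@continuous_comp _ _ _ (fun x => (x, g)) (fun z => z.1 * z.2)%g).
  by apply: cvg_pair => /=; [exact: cvg_id | exact: cvg_cst].
exact: mulg_continuous.
Qed.

Definition conjset g A : set G := [set x | A (g^-1 * x * g)%g].

Lemma open_lcoset g A : open A -> open [set x | A (g^-1 * x)%g].
Proof. by move=> oA; move/continuousP: (@mulgl_continuous (g^-1)%g); apply. Qed.

Lemma osub_conj g A : open_subgroup A -> open_subgroup (conjset g A).
Proof.
move=> sA; split.
  have /continuousP h := @mulgr_continuous g.
  exact: (@open_lcoset g _ (h _ sA.1)).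
apply/group_closedP; split; rewrite /conjset /=.
  by rewrite mulg1 mulVg; exact: osub1.
move=> x y Ax Ay; have := osubF sA Ax Ay.
by rewrite !invgM invgK !mulgA mulgK.
Qed.

Lemma conj_mul g h A : conjset (g * h)%g A = conjset g (conjset h A).
Proof. by apply/seteqP; split=> x; rewrite /conjset /= invgM !mulgA. Qed.

Lemma conj1 A : conjset 1%g A = A.
Proof. by apply/seteqP; split=> x; rewrite /conjset /= invg1 mul1g mulg1. Qed.

Lemma conjK g A : conjset (g^-1)%g (conjset g A) = A.
Proof. by rewrite -conj_mul mulVg conj1. Qed.

Lemma conj_id g A : open_subgroup A -> A g -> conjset g A = A.
Proof.
move=> sA Ag; apply/seteqP; split=> x; rewrite /conjset /= => Ax.
  have := osubF sA (osubM sA Ag Ax) Ag.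
  by rewrite !mulgA mulgV mul1g mulgK.
by apply: osubM => //; apply: osubM => //; exact: osubV.
Qed.

Lemma conj_sub g A B : A `<=` B -> conjset g A `<=` conjset g B.
Proof. by move=> AB x; exact: AB. Qed.

Lemma conjM_in g u A : open_subgroup A -> A u -> conjset (g * u)%g A = conjset g A.
Proof. by move=> sA Au; rewrite conj_mul (conj_id sA Au). Qed.

Lemma osub_nbhs A : open_subgroup A -> nbhs 1%g A.
Proof. by move=> sA; apply: open_nbhs_nbhs; split; [case: sA | exact: osub1]. Qed.

Lemma osub_super L U : group_closed [in L] -> open_subgroup U -> U `<=` L -> open_subgroup L.
Proof.
move=> gL sU UL; split=> //; rewrite openE => x Lx.
have nx : nbhs x [set z | U (x^-1 * z)%g].
  apply: open_nbhs_nbhs; split; first exact: open_lcoset sU.1.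
  by rewrite /= mulVg; exact: osub1.
apply: filterS nx => z /= Uz.
have -> : z = (x / (x^-1 * z)^-1)%g by rewrite invgK mulVKg.
by case/group_closedP: gL => _; apply=> //; apply: UL; exact: osubV.
Qed.

Lemma nonarch_nbhs : non_archimedean G -> forall A, nbhs 1%g A ->
  exists2 U, open_subgroup U & U `<=` A.
Proof.
move=> na A; rewrite nbhsE => -[B oB BA].
by have [U [oU gU UB]] := na B oB; exists U => //; exact: subset_trans BA.
Qed.

End OpenSubgroups.

(** * Orthogonal representations *)

Section Representations.
Variables (R : realType) (G : topologicalGroupType).

Record ortho_rep := OrthoRep {
  rep_space :> real_hilbert R;
  act : G -> rep_space -> rep_space;
  act1 : forall x, act 1%g x = x;
  actM : forall g h x, act (g * h)%g x = act g (act h x);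
  actD : forall g x y, act g (x + y) = act g x + act g y;
  actZ : forall g r x, act g (r *: x) = r *: act g x;
  act_ip : forall g x y, ip (act g x) (act g y) = ip x y;
  act_cont : forall x e, 0 < e -> exists2 U, open_subgroup U &
     forall u, U u -> q (act u x - x) < e }.

Section OneRep.
Variable r : ortho_rep.
Implicit Types (x y z : r) (A B : set G) (M N : set r) (g h : G).

Lemma act0 g : act g (0 : r) = 0.
Proof. by rewrite -[X in act g X](scale0r (0 : r)) actZ scale0r. Qed.
Lemma actN g x : act g (- x) = - act g x.
Proof. by rewrite -scaleN1r actZ scaleN1r. Qed.
Lemma actB g x y : act g (x - y) = act g x - act g y.
Proof. by rewrite actD actN. Qed.
Lemma actK g x : act (g^-1)%g (act g x) = x.
Proof. by rewrite -actM mulVg act1. Qed.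
Lemma actVK g x : act g (act (g^-1)%g x) = x.
Proof. by rewrite -actM mulgV act1. Qed.
Lemma q_act g x : q (act g x) = q x.
Proof. exact: act_ip. Qed.
Lemma q_actB g x y : q (act g x - act g y) = q (x - y).
Proof. by rewrite -actB q_act. Qed.
Lemma act_ipl g x y : ip (act g x) y = ip x (act (g^-1)%g y).
Proof. by rewrite -(act_ip (g^-1)%g) actK. Qed.

Lemma act_clos g M N x : (forall m, M m -> N (act g m)) ->
  clos M x -> clos N (act g x).
Proof.
move=> MN cx e /cx[k Mk xk]; exists (act g k); first exact: MN.
by rewrite q_actB.
Qed.

Lemma act_proj g M N x : subspace M -> subspace N ->
  (forall m, M m -> N (act g m)) -> (forall n, N n -> M (act (g^-1)%g n)) ->
  act g (oproj M x) = oproj N (act g x).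
Proof.
move=> Ms Ns MN NM; apply/esym; apply: proj_unique => //.
  by apply: act_clos MN _; exact: proj_clos.
move=> n Nn; rewrite -actB act_ipl proj_orth //.
by apply: sub_clos; exact: NM.
Qed.

Definition fix_by A : set r := [set x | forall g, A g -> act g x = x].
Definition finite_orbit A : set r := [set x | finite_set [set act g x | g in A]].

Lemma subspace_fix A : subspace (fix_by A).
Proof.
split=> [g _|x y fx fy g Ag|t x fx g Ag]; first exact: act0.
  by rewrite actD fx // fy.
by rewrite actZ fx.
Qed.

Lemma qclosed_fix A : qclosed (fix_by A).
Proof.
move=> x cx g Ag; apply/eqP; rewrite -subr_eq0; apply/eqP/q_eq0/eqP.
rewrite eq_le q_ge0 andbT; apply/ler_addgt0Pr => e e0; rewrite add0r.
have [k fk xk] := cx (e / 4) (divr_gt0 e0 (ltr0n _ 4)).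
have := q_tri (act g x) k x; rewrite -{1}(fk g Ag) q_actB (qBC k).
by move=> h; apply: le_trans h _; lra.
Qed.

Lemma subspace_fin A : subspace (finite_orbit A).
Proof.
split; rewrite /finite_orbit /=.
- apply: (@sub_finite_set _ _ [set 0]) => [_ [g _ <-]|]; first exact: act0.
  exact: finite_set1.
- move=> x y fx fy.
  pose S := (fun p : r * r => p.1 + p.2) @`
    ([set act g x | g in A] `*` [set act g y | g in A]).
  apply: (@sub_finite_set _ _ S) => [_ [g Ag <-]|].
    by exists (act g x, act g y); [split; exists g | rewrite actD].
  by apply: finite_image; exact: finite_setX.
- move=> t x fx.
  apply: (@sub_finite_set _ _ (( *:%R t) @` [set act g x | g in A])).
    by move=> _ [g Ag <-]; exists (act g x); [exists g | rewrite actZ].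
  exact: finite_image.
Qed.

Lemma fin_sub A B : A `<=` B -> finite_orbit B `<=` finite_orbit A.
Proof. by move=> AB x; apply: sub_finite_set => _ [g /AB ? <-]; exists g. Qed.

Lemma fix_fin A : fix_by A `<=` finite_orbit A.
Proof.
move=> x fx; apply: (@sub_finite_set _ _ [set x]) => [_ [g Ag <-]|].
  exact: fx.
exact: finite_set1.
Qed.

Lemma fin_conj g A x : finite_orbit A x -> finite_orbit (conjset g A) (act g x).
Proof.
move=> fx; apply: (@sub_finite_set _ _ (act g @` [set act h x | h in A])).
  move=> _ [h Ah <-]; exists (act (g^-1 * h * g)%g x).
    by exists (g^-1 * h * g)%g.
  by rewrite -!actM !mulgA mulgV mul1g.
exact: finite_image.
Qed.

Lemma fin_act g A x : open_subgroup A -> A g -> finite_orbit A x -> finite_orbit A (act g x).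
Proof. by move=> sA Ag /(fin_conj g); rewrite conj_id. Qed.

Lemma act_proj_fin g A x :
  act g (oproj (finite_orbit A) x) = oproj (finite_orbit (conjset g A)) (act g x).
Proof.
apply: act_proj; try exact: subspace_fin; first by move=> m; exact: fin_conj.
by move=> m /(fin_conj (g^-1)%g); rewrite conjK.
Qed.

Lemma act_proj_fin_in g A x : open_subgroup A -> A g ->
  act g (oproj (finite_orbit A) x) = oproj (finite_orbit A) (act g x).
Proof. by move=> sA Ag; rewrite act_proj_fin conj_id. Qed.

Lemma finite_gap (S : set r) x : finite_set S ->
  exists2 e, 0 < e & forall s, S s -> q (s - x) < e -> s = x.
Proof.
move=> /finite_seqP[s ->]; elim: s => [|a s [e e0 IH]].
  by exists 1.
have [->|ax] := eqVneq a x.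
  by exists e => // b /=; rewrite inE => /orP[/eqP|bs] //; exact: IH.
have qa : 0 < q (a - x) by apply: q_gt0; rewrite subr_eq0.
exists (Num.min e (q (a - x))); first by rewrite lt_min e0.
move=> b /=; rewrite inE lt_min => /orP[/eqP ->|bs] /andP[h1 h2].
  by rewrite ltxx in h2.
exact: IH.
Qed.

(** A finite orbit is discrete and the action is continuous, so the stabiliser
    is open. *)
Lemma fin_fix_open A x : open_subgroup A -> finite_orbit A x ->
  exists2 U, open_subgroup U /\ U `<=` A & fix_by U x.
Proof.
move=> sA /(@finite_gap _ x)[e e0 gap]; have [U sU Ue] := act_cont x e0.
exists (U `&` A); first by split; [exact: osubI | exact: subIsetr].
by move=> u [Uu Au]; apply: gap; [exists u | exact: Ue].
Qed.

(** The point of least norm in the closed convex hull of the orbit of x is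
    fixed by uniqueness, and has the same projection as x because the projection
    on the fixed vectors is constant on the hull. *)
Lemma proj_fix_hull A (K : set r) x : open_subgroup A -> qclosed K -> convex K ->
  (forall a, A a -> K (act a x)) -> K (oproj (fix_by A) x).
Proof.
move=> sA Kcl Kcv Kx.
pose hull := [set y : r | forall L : set r, qclosed L -> convex L ->
  (forall a, A a -> L (act a x)) -> L y].
have hcl : qclosed hull.
  move=> y cy L Lcl Lcv Lx; apply: (Lcl); apply: clos_sub cy => z hz; exact: (hz L Lcl Lcv Lx).
have hcv : convex hull.
  by move=> y z t hy hz t01 L Lcl Lcv Lx; apply: (Lcv) => //;
    [exact: (hy L Lcl Lcv Lx)|exact: (hz L Lcl Lcv Lx)].
have hx a : A a -> hull (act a x) by move=> Aa L _ _; exact.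
have [w hw wmin] : exists2 w, hull w & forall k, hull k -> q (0 - w) <= q (0 - k).
  apply: nearest_point => //; exists (act 1%g x); apply: hx; exact: osub1.
have hact a y : A a -> hull y -> hull (act a y).
  move=> Aa hy L Lcl Lcv Lx; apply: (hy [set z | L (act a z)]).
  - by move=> z cz /=; apply: Lcl; apply: act_clos cz.
  - by move=> u v t Lu Lv t01 /=; rewrite actD !actZ; exact: Lcv.
  - by move=> b Ab /=; rewrite -actM; apply: Lx; exact: osubM.
have wfix : fix_by A w.
  move=> a Aa; apply: (@nearest_point_unique _ _ hull 0) => //; first exact: hact.
  by rewrite !sub0r !qN q_act.
suff -> : oproj (fix_by A) x = w by exact: hw.
have Ms := subspace_fix A.
rewrite -(proj_id Ms (sub_clos wfix)); apply/esym.
apply: (hw [set z | oproj (fix_by A) z = oproj (fix_by A) x]).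
- move=> z cz /=; apply/eqP; rewrite -subr_eq0; apply/eqP/q_eq0/eqP.
  rewrite eq_le q_ge0 andbT; apply/ler_addgt0Pr => e e0; rewrite add0r.
  have [k <- zk] := cz e e0; rewrite -projB //.
  by apply: le_trans (q_proj_le _ Ms) _; exact: ltW.
- move=> u v t /= hu hv _; rewrite projD // !projZ // hu hv -scalerDl.
  by rewrite addrC subrK scale1r.
- move=> a Aa /=; rewrite -(act_proj _ Ms Ms).
  + by apply: qclosed_fix Aa; exact: proj_clos.
  + by move=> m fm; rewrite fm.
  + by move=> m fm; rewrite fm //; exact: osubV.
Qed.

End OneRep.
End Representations.

(** * Weak limits *)

Section UltraLimits.
Variable R : realType.

(** The limit is the supremum of the x such that x <= f on a large set. *)
Lemma ultra_limit (T : Type) (F : set_system T) (f : T -> R) (B : R) :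
  UltraFilter F -> F [set t | `|f t| <= B] ->
  exists L, forall e, 0 < e -> F [set t | `|f t - L| < e].
Proof.
move=> UF FB; have PF := @ultra_proper _ _ UF.
pose S := [set x : R | F [set t | x <= f t]].
have hS : has_sup S.
  split.
    exists (- B); apply: filterS FB => t /=; rewrite ler_norml => /andP[]; lra.
  exists B => x Sx; have [t [/= h1 h2]] := filter_ex (filterI Sx FB).
  by move: h2; rewrite ler_norml => /andP[_]; lra.
exists (sup S) => e e0.
have h1 : F [set t | f t < sup S + e].
  have [h|h] := in_ultra_setVsetC [set t | f t < sup S + e] UF => //.
  have /(ub_le_sup hS.2) : S (sup S + e).
    by apply: filterS h => t /= /negP; rewrite -leNgt.
  by rewrite gerDl leNgt e0.
have [x Sx xe] := sup_adherent e0 hS.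
apply: filterS (filterI h1 Sx) => t /= [h2 h3].
by rewrite ltr_norml; apply/andP; split; lra.
Qed.

Variable H : real_hilbert R.

Lemma ip_small (d : H) e : 0 < e ->
  exists2 c, 0 < c & forall x : H, q x < c -> `|ip x d| < e.
Proof.
move=> e0; have q1 : 0 < q d + 1 by have := q_ge0 d; lra.
exists (e ^+ 2 / (q d + 1)); first by rewrite divr_gt0 ?exprn_gt0.
move=> x; rewrite ltr_pdivlMr // => xd.
have h : ip x d ^+ 2 < e ^+ 2.
  apply: le_lt_trans (cauchy_schwarz x d) _; apply: le_lt_trans xd.
  by have := q_ge0 x; lra.
by rewrite ltr_norml; apply/andP; split; nra.
Qed.

(** The ultralimit of the coefficients is a bounded functional, hence given by a
    vector: bounded families converge weakly along ultrafilters. *)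
Lemma weak_limit (T : Type) (F : set_system T) (f : T -> H) (B : R) :
  UltraFilter F -> (forall t, q (f t) <= B) ->
  exists w, forall y e, 0 < e -> F [set t | `|ip (f t - w) y| < e].
Proof.
move=> UF fB; have PF := @ultra_proper _ _ UF.
have lim y : exists L, forall e, 0 < e -> F [set t | `|ip (f t) y - L| < e].
  apply: (@ultra_limit _ _ _ (B + q y)) => //; apply: filterE => t /=.
  have := q_ge0 (f t - y); have := q_ge0 (f t + y).
  rewrite qB qD => h1 h2; rewrite ler_norml; have := fB t; have := q_ge0 (f t).
  have := q_ge0 y => h3 h4 h5.
  by apply/andP; split; lra.
have [g gP] := boolp.choice lim.
have eq0 (x : R) : (forall e, 0 < e -> `|x| < e) -> x = 0.
  move=> h; apply/eqP; rewrite -normr_eq0 eq_le normr_ge0 andbT.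
  by apply/ler_addgt0Pr => e /h /ltW; rewrite add0r.
have gD x y : g (x + y) = g x + g y.
  apply/eqP; rewrite -subr_eq0; apply/eqP/eq0 => e e0.
  have e3 : 0 < e / 3 by lra.
  have [t [/= + [/=]]] := filter_ex (filterI (gP (x + y) _ e3)
    (filterI (gP x _ e3) (gP y _ e3))).
  by rewrite ipDr !ltr_norml => /andP[? ?] /andP[? ?] /andP[? ?]; apply/andP; split; lra.
have gZ a x : g (a *: x) = a * g x.
  apply/eqP; rewrite -subr_eq0; apply/eqP/eq0 => e e0.
  have e3 : 0 < e / 2 by lra.
  have a1 : 0 < `|a| + 1 by have := normr_ge0 a; lra.
  have [t [/= + /=]] := filter_ex (filterI (gP (a *: x) _ e3)
    (gP x _ (divr_gt0 e3 a1))).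
  rewrite ipZr (ltr_pdivlMr _ _ a1) => h1 h2.
  have -> : g (a *: x) - a * g x =
    - (a * ip (f t) x - g (a *: x)) + a * (ip (f t) x - g x) by ring.
  apply: le_lt_trans (ler_normD _ _) _; rewrite normrN normrM.
  have := normr_ge0 (ip (f t) x - g x) => h3.
  by lra.
have gB x : g x ^+ 2 <= (2 * B) * q x.
  apply/ler_addgt0Pr => e e0.
  pose c := Num.min 1 (e / 2).
  have c0 : 0 < c by rewrite lt_min; apply/andP; split; lra.
  have [t /= ht] := filter_ex (gP x _ c0).
  have := cauchy_schwarz (f t) x.
  set a := ip (f t) x in ht *; set d := a - g x in ht.
  have -> : g x = a - d by rewrite /d; ring.
  have h2 : (a - d) ^+ 2 <= 2 * a ^+ 2 + 2 * d ^+ 2 by have := sqr_ge0 (a + d); lra.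
  have h3 : d ^+ 2 <= e / 2.
    apply: (@le_trans _ _ (c * c)).
      rewrite -[d ^+ 2]real_normK ?num_real // expr2; apply: ler_pM => //; exact: ltW.
    have : c <= 1 by rewrite ge_min lexx.
    have : c <= e / 2 by rewrite ge_min lexx orbT.
    move=> h4 h5; apply: le_trans h4.
    by rewrite -[X in _ <= X]mulr1; apply: ler_wpM2l => //; exact: ltW.
  move=> h4; have := ler_wpM2r (q_ge0 x) (fB t); lra.
have [w wP] := riesz gD gZ gB.
by exists w => y e e0; apply: filterS (gP y e e0) => t /=; rewrite ipBl -wP.
Qed.

End UltraLimits.

Section FiniteReals.
Variable R : realType.
Implicit Types (S : set R) (e x : R).

Lemma finite_pos_gap S : finite_set S ->
  exists2 e, 0 < e & forall s, S s -> s < e -> s <= 0.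
Proof.
move=> /finite_seqP[s ->]; elim: s => [|a s [e e0 IH]]; first by exists 1.
have [a0|a0] := leP a 0.
  by exists e => // b /=; rewrite inE => /orP[/eqP ->|bs] //; exact: IH.
exists (Num.min e a); first by rewrite lt_min e0.
move=> b /=; rewrite inE lt_min => /orP[/eqP ->|bs] /andP[h1 h2].
  by rewrite ltxx in h2.
exact: IH.
Qed.

Lemma finite_min S : finite_set S -> S !=set0 ->
  exists2 m, S m & forall s, S s -> m <= s.
Proof.
move=> /finite_seqP[s ->]; elim: s => [|a [|b s] IH]; first by case.
  by move=> _; exists a; rewrite /= ?inE // => c; rewrite /= inE => /eqP ->.
move=> _; have [|m ms mmin] := IH; first by exists b; rewrite /= inE eqxx.
have [am|ma] := leP a m.
  exists a; first by rewrite /= inE eqxx.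
  by move=> c; rewrite /= inE => /orP[/eqP ->|/mmin] //; exact: le_trans.
exists m; first by rewrite /= inE ms orbT.
by move=> c; rewrite /= inE => /orP[/eqP ->|/mmin] //; exact: ltW.
Qed.

Lemma finite_closed S x : finite_set S ->
  (forall e, 0 < e -> exists2 s, S s & `|s - x| < e) -> S x.
Proof.
move=> fS h; have [e e0 he] := finite_pos_gap (finite_image (fun s => `|s - x|) fS).
have [s Ss sx] := h e e0.
have /he/(_ sx) : ((fun s => `|s - x|) @` S) `|s - x| by exists s.
by rewrite normr_le0 subr_eq0 => /eqP <-.
Qed.

End FiniteReals.

(** * Weak mixing *)

Section WeakMixing.
Variables (R : realType) (G : topologicalGroupType).
Hypothesis rG : roelcke_precompact G.

Lemma double_cosets (U : set G) : open_subgroup U -> exists s : seq G,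
  forall g, exists u e v, [/\ U u, e \in s, U v & g = (u * e * v)%g].
Proof.
move=> sU; have [E /finite_seqP[s ->] hE] := rG (conj sU.1 (osub1 sU) : open_nbhs _ _).
by exists s.
Qed.

Section OneRep.
Variable r : ortho_rep R G.
Implicit Types (U V : set G) (x y z w : r) (e c : R).

Lemma finite_coeffs U x y : open_subgroup U -> fix_by U x -> fix_by U y ->
  finite_set (range (fun g => ip (act g x) y)).
Proof.
move=> sU fx fy; have [s hs] := double_cosets sU.
apply: (@sub_finite_set _ _ ((fun g => ip (act g x) y) @` [set` s])).
  move=> _ [g _ <-]; have [u [a [v [Uu As Uv ->]]]] := hs g.
  exists a => //=; rewrite !actM (fx v) // [RHS]act_ipl fy //; exact: osubV.
exact/finite_image/finite_seq.
Qed.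

(** The closed half-space used here contains the orbit of x by the hypothesis;
    that it contains the projection too is the claim. *)
Lemma proj_fix_near U x c : open_subgroup U -> (forall u, U u -> q (act u x - x) <= c) ->
  q (x - oproj (fix_by U) x) <= c.
Proof.
move=> sU h; set d := x - _.
pose K := [set y : r | ip (x - y) d <= (c + q d) / 2].
suff : K (oproj (fix_by U) x).
  by move=> hK; have {hK} : ip d d <= (c + q d) / 2 := hK; rewrite /q; lra.
apply: proj_fix_hull => //.
- move=> y cy; rewrite /K /=; apply/ler_addgt0Pr => e e0.
  have [b b0 hb] := ip_small d e0; have [k Kk yk] := cy b b0.
  have -> : x - y = (x - k) - (y - k) by rewrite opprB addrA subrK.
  by move: (hb _ yk) Kk; rewrite /K /= (ipBl (x - k)) ltr_norml => /andP[? ?]; lra.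
- move=> y z t; rewrite /K /= => hy hz /andP[t0 t1].
  have -> : x - (t *: y + (1 - t) *: z) = t *: (x - y) + (1 - t) *: (x - z).
    rewrite !scalerBr addrACA -scalerDl -opprD.
    by rewrite [t + _]addrC subrK scale1r.
  rewrite ipDl !ipZl.
  have := ler_wpM2l t0 hy; have t1' : 0 <= 1 - t by lra.
  by have := ler_wpM2l t1' hz; lra.
- move=> u Uu; rewrite /K /=; have := h u Uu; have := q_ge0 ((x - act u x) - d).
  by rewrite (qB (x - _)) (qBC x); lra.
Qed.

(** Precompactness of the V-orbit of z, phrased with ultrafilters.  The map v is
    arbitrary, so that the property visibly passes to translates of z. *)
Definition almost_periodic V z := forall (F : set_system G) (v : G -> G) e,
  UltraFilter F -> (forall g, V (v g)) -> 0 < e ->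
  exists w, F [set g | q (act (v g) z - w) < e].

Lemma almost_periodic_convex V : convex (almost_periodic V).
Proof.
move=> x y t hx hy /andP[t0 t1] F v e UF vV e0; have e4 : 0 < e / 4 by lra.
have [w1 h1] := hx F v _ UF vV e4; have [w2 h2] := hy F v _ UF vV e4.
have PF := @ultra_proper _ _ UF.
exists (t *: w1 + (1 - t) *: w2); apply: filterS (filterI h1 h2) => g /= [].
set a := act _ x - w1; set b := act _ y - w2 => ha hb.
have -> : act (v g) (t *: x + (1 - t) *: y) - (t *: w1 + (1 - t) *: w2) =
  t *: a - - ((1 - t) *: b).
  by rewrite opprK actD !actZ opprD addrACA -!scalerBr.
have := q_tri (t *: a) 0 (- ((1 - t) *: b)).
rewrite subr0 sub0r opprK !qZ.
have : t ^+ 2 <= 1 by rewrite expr_le1.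
have : (1 - t) ^+ 2 <= 1 by rewrite expr_le1 //; lra.
move=> h3 h4.
have := ler_wpM2r (q_ge0 a) h4; have := ler_wpM2r (q_ge0 b) h3; lra.
Qed.

Lemma almost_periodic_closed V : qclosed (almost_periodic V).
Proof.
move=> x cx F v e UF vV e0; have e4 : 0 < e / 4 by lra.
have [k hk xk] := cx _ e4; have [w hw] := hk F v _ UF vV e4.
have PF := @ultra_proper _ _ UF.
exists w; apply: filterS hw => g /=.
by have := q_tri (act (v g) x) (act (v g) k) w; rewrite q_actB; lra.
Qed.

(** The orbit of a vector fixed by an open subgroup is uniformly discrete, since
    there are finitely many double cosets; a precompact such orbit is finite. *)
Lemma almost_periodic_fin U V z : open_subgroup U -> open_subgroup V -> fix_by U z ->
  almost_periodic V z -> finite_orbit V z.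
Proof.
move=> sU sV fz ap.
have := finite_image (fun c => 2 * (q z - c)) (finite_coeffs sU fz fz).
move=> /finite_pos_gap[e e0 gap].
have disc g h : q (act g z - act h z) < e -> act g z = act h z.
  move=> gh; apply/eqP; rewrite -subr_eq0; apply/eqP/q_eq0/eqP.
  rewrite eq_le q_ge0 andbT; apply: gap gh.
  exists (ip (act (h^-1 * g)%g z) z); first by exists (h^-1 * g)%g.
  by rewrite actM act_ipl invgK qB !q_act; ring.
apply: contrapT => inf.
(* A filter on V along which g z leaves every finite set. *)
pose F0 := [set A : set G | exists2 S : set r, finite_set S &
  [set g | V g /\ ~ S (act g z)] `<=` A].
have PF0 : ProperFilter F0.
  split.
    move=> [S fS h]; apply: inf; apply: sub_finite_set fS => _ [g Vg <-].
    by apply: contrapT => nS; exact: (h g).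
  split.
  - by exists set0 => //; exact: finite_set0.
  - move=> A B [S fS hA] [T fT hB]; exists (S `|` T); first by rewrite finite_setU.
    move=> g [Vg nST]; split; [apply: hA | apply: hB]; split=> // h; apply: nST.
      by left.
    by right.
  - by move=> A B AB [S fS hA]; exists S => //; exact: subset_trans AB.
have [F [UF F0F]] := ultraFilterLemma PF0; have PF := @ultra_proper _ _ UF.
pose v g := if `[< V g >] then g else 1%g.
have vV g : V (v g) by rewrite /v; case: asboolP => // _; exact: osub1.
have [|w Fw] := ap F v (e / 4) UF vV; first by lra.
have [g0 /= hg0] := filter_ex Fw.
have : F [set g | V g /\ ~ [set act (v g0) z] (act g z)].
  by apply: F0F; exists [set act (v g0) z] => //; exact: finite_set1.
move=> /(filterI Fw)/filter_ex[g [/= hg [Vg]]]; apply.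
apply: disc; move: hg; rewrite /v asboolT // => hg.
have := q_tri (act g z) w (act (v g0) z); rewrite (qBC w).
by move: hg hg0; rewrite /v; lra.
Qed.

(** The weak closure of the orbit V x. *)
Definition weak_orbit V x := [set z : r | forall (s : seq r) e, 0 < e ->
  exists2 v, V v & forall y, y \in s -> `|ip (act v x - z) y| < e].

(** The squared norm of a weak limit is an iterated limit of coefficients, which
    take finitely many values. *)
Lemma weak_orbit_norm U V x z : open_subgroup U -> fix_by U x -> open_subgroup V ->
  weak_orbit V x z -> range (fun g => ip (act g x) x) (q z).
Proof.
move=> sU fx sV hz; apply: finite_closed; first exact: (finite_coeffs sU fx fx).
move=> e e0; have e2 : 0 < e / 2 by lra.
have [w Vw hw] := hz [:: z] _ e2; have [v Vv hv] := hz [:: act w x] _ e2.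
exists (ip (act v x) (act w x)).
  exists (w^-1 * v)%g => //; by rewrite actM act_ipl invgK.
have := hw z; have := hv (act w x); rewrite !inE !eqxx !ipBl.
move=> /(_ isT) + /(_ isT); rewrite /q (ipC z (act w x)) !ltr_norml.
by move=> /andP[? ?] /andP[? ?]; apply/andP; split; lra.
Qed.

Lemma weak_orbit_lim V x z w (F : set_system G) (v : G -> G) : open_subgroup V ->
  UltraFilter F -> (forall g, V (v g)) -> weak_orbit V x z ->
  (forall y e, 0 < e -> F [set g | `|ip (act (v g) z - w) y| < e]) ->
  weak_orbit V x w.
Proof.
move=> sV UF vV hz hw s e e0; have PF := @ultra_proper _ _ UF.
have e2 : 0 < e / 2 by lra.
have : F [set g | forall y, y \in s -> `|ip (act (v g) z - w) y| < e / 2].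
  elim: s => [|y s IH]; first by apply: filterE.
  apply: filterS (filterI (hw y _ e2) IH) => g /= [h1 h2] y'.
  by rewrite inE => /orP[/eqP ->|/h2].
move=> /filter_ex[g /= hg].
have [u Vu hu] := hz [seq act ((v g)^-1)%g y | y <- s] _ e2.
exists (v g * u)%g; first exact: osubM.
move=> y ys; have := hg y ys; have := hu _ (map_f _ ys).
rewrite -act_ipl actB -actM !ipBl !ltr_norml.
by move=> /andP[? ?] /andP[? ?]; apply/andP; split; lra.
Qed.

(** A point z of least norm in the weak closure of the orbit (it exists because
    only finitely many norms occur) has no orbit losing norm in a weak limit, so
    its orbit is precompact; then z is a limit of vectors with finite orbit, to
    which it is orthogonal. *)
Lemma weak_mixing1 U V x : open_subgroup U -> open_subgroup V -> fix_by U x ->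
  (forall m, finite_orbit V m -> ip x m = 0) -> weak_orbit V x 0.
Proof.
move=> sU sV fx xo.
have [] := @finite_min _ [set q z | z in weak_orbit V x].
- apply: sub_finite_set (finite_coeffs sU fx fx) => _ [z hz <-].
  exact: (weak_orbit_norm sU fx sV hz).
- exists (q x), x => // s e e0; exists 1%g; first exact: osub1.
  by move=> y _; rewrite act1 subrr ip0l normr0.
move=> _ [z hz <-] zmin.
have zo m : finite_orbit V m -> ip z m = 0.
  move=> fm; apply/eqP; rewrite -normr_eq0 eq_le normr_ge0 andbT.
  apply/ler_addgt0Pr => e e0; have [v Vv hv] := hz [:: m] e e0.
  have := hv m; rewrite inE eqxx => /(_ isT).
  rewrite ipBl act_ipl xo; first by rewrite sub0r normrN add0r => /ltW.
  by apply: fin_act fm => //; exact: osubV.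
have zap : almost_periodic V z.
  move=> F v e UF vV e0; have PF := @ultra_proper _ _ UF.
  have [|w hw] := @weak_limit R r _ F (fun g => act (v g) z) (q z) UF.
    by move=> g; rewrite q_act.
  have wZ : weak_orbit V x w by exact: weak_orbit_lim hw.
  have zw : q z <= q w by apply: zmin; exists w.
  exists w; have e2 : 0 < e / 2 by lra.
  apply: filterS (hw w _ e2) => g /=; rewrite ipBl -/(q w) ltr_norml.
  by move=> /andP[? ?]; rewrite qB q_act; lra.
suff -> : 0 = z by [].
apply/esym/q_eq0; apply: (orth_clos zo) => e e0.
have [W sW hW] := act_cont z (divr_gt0 e0 (ltr0n _ 2)).
have sWV := osubI sW sV.
exists (oproj (fix_by (W `&` V)) z); last first.
  apply: le_lt_trans (_ : _ <= e / 2) _; last by lra.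
  by apply: proj_fix_near => // u [Wu _]; apply: ltW; exact: hW.
apply: (@almost_periodic_fin (W `&` V)) => //.
  by apply: qclosed_fix; apply: proj_clos; exact: subspace_fix.
apply: proj_fix_hull => //; [exact: almost_periodic_closed | exact: almost_periodic_convex |].
move=> a [_ Va] F v c UF vV c0.
have [|w hw] := zap F (fun g => v g * a)%g c UF _ c0.
  by move=> g; exact: osubM.
by exists w; apply: filterS hw => g /=; rewrite actM.
Qed.

End OneRep.
End WeakMixing.

(** * Direct sums *)

Section DirectSum.
Variables (R : realType) (I : finType) (H : I -> real_hilbert R).

Definition dsum_type := forall i, H i.

HB.instance Definition _ := gen_eqMixin dsum_type.
HB.instance Definition _ := gen_choiceMixin dsum_type.

Let add (x y : dsum_type) : dsum_type := fun i => x i + y i.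
Let opp (x : dsum_type) : dsum_type := fun i => - x i.
Let zero : dsum_type := fun i => 0.
Let scale (a : R) (x : dsum_type) : dsum_type := fun i => a *: x i.

Let addA : associative add.
Proof. by move=> x y z; apply: functional_extensionality_dep => i; apply: addrA. Qed.
Let addC : commutative add.
Proof. by move=> x y; apply: functional_extensionality_dep => i; apply: addrC. Qed.
Let add0 : left_id zero add.
Proof. by move=> x; apply: functional_extensionality_dep => i; apply: add0r. Qed.
Let addN : left_inverse zero opp add.
Proof. by move=> x; apply: functional_extensionality_dep => i; apply: addNr. Qed.

HB.instance Definition _ := GRing.isZmodule.Build dsum_type addA addC add0 addN.

Let scaleA a b x : scale a (scale b x) = scale (a * b) x.
Proof. by apply: functional_extensionality_dep => i; apply: scalerA. Qed.
Let scale1 : left_id 1 scale.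
Proof. by move=> x; apply: functional_extensionality_dep => i; apply: scale1r. Qed.
Let scaleDr : right_distributive scale +%R.
Proof. by move=> a x y; apply: functional_extensionality_dep => i; apply: scalerDr. Qed.
Let scaleDl x : {morph scale^~ x : a b / a + b}.
Proof. by move=> a b; apply: functional_extensionality_dep => i; apply: scalerDl. Qed.

HB.instance Definition _ := GRing.Zmodule_isLmodule.Build R dsum_type
  scaleA scale1 scaleDr scaleDl.

Definition dsum_ip (x y : dsum_type) : R := \sum_i ip (x i) (y i).

Let ipC' x y : dsum_ip x y = dsum_ip y x.
Proof. by apply: eq_bigr => i _; exact: ipC. Qed.
Let ipDl' x y z : dsum_ip (x + y) z = dsum_ip x z + dsum_ip y z.
Proof. by rewrite -big_split; apply: eq_bigr => i _; exact: ipDl. Qed.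
Let ipZl' a x y : dsum_ip (a *: x) y = a * dsum_ip x y.
Proof. by rewrite /dsum_ip big_distrr; apply: eq_bigr => i _; exact: ipZl. Qed.
Let ip_ge0' x : 0 <= dsum_ip x x.
Proof. by apply: sumr_ge0 => i _; exact: ip_ge0. Qed.

Let coord_le x i : ip (x i) (x i) <= dsum_ip x x.
Proof.
rewrite /dsum_ip (bigD1 i) //= lerDl; apply: sumr_ge0 => j _; exact: ip_ge0.
Qed.

Let ip_eq0' x : dsum_ip x x = 0 -> x = 0.
Proof.
move=> x0; apply: functional_extensionality_dep => i; apply: ip_eq0.
by apply/eqP; rewrite eq_le ip_ge0 andbT -x0 coord_le.
Qed.

Let complete' (u : nat -> dsum_type) :
  (forall e, 0 < e -> exists N, forall m n, (N <= m)%N -> (N <= n)%N ->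
     dsum_ip (u m - u n) (u m - u n) < e) ->
  exists l, forall e, 0 < e -> exists N, forall n, (N <= n)%N ->
     dsum_ip (u n - l) (u n - l) < e.
Proof.
move=> cu.
have lim i : exists l : H i, forall e, 0 < e -> exists N, forall n, (N <= n)%N ->
     ip (u n i - l) (u n i - l) < e.
  apply: ip_complete => e /cu[N hN]; exists N => m n hm hn.
  by apply: le_lt_trans (hN m n hm hn); exact: (coord_le (u m - u n) i).
exists (fun i => projT1 (cid (lim i))) => e e0.
have c0 : 0 < e / (#|I|.+1)%:R by rewrite divr_gt0.
pose N i := projT1 (cid (projT2 (cid (lim i)) _ c0)).
exists (\max_i N i)%N => n hn.
apply: (@le_lt_trans _ _ (\sum_(i : I) e / (#|I|.+1)%:R)).
  apply: ler_sum => i _; apply: ltW.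
  apply: (projT2 (cid (projT2 (cid (lim i)) _ c0))).
  by apply: leq_trans hn; exact: (leq_bigmax i).
by rewrite sumr_const -[_ / _ *+ _]mulr_natr mulrAC ltr_pdivrMr // ltr_pM2l // ltr_nat.
Qed.

Definition dsum : real_hilbert R := RealHilbert ipC' ipDl' ipZl' ip_ge0' ip_eq0' complete'.

End DirectSum.

Section DirectSumRep.
Variables (R : realType) (G : topologicalGroupType).

Lemma osub_family (I : finType) (U : I -> set G) : (forall i, open_subgroup (U i)) ->
  exists2 W, open_subgroup W & forall i, W `<=` U i.
Proof.
move=> sU.
suff [W sW hW] : exists2 W, open_subgroup W & forall i, i \in enum I -> W `<=` U i.
  by exists W => // i; apply: hW; rewrite mem_enum.
elim: (enum I) => [|i s [W sW hW]]; first by exists setT; [exact: osubT|].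
exists (U i `&` W); first exact: osubI.
move=> j; rewrite inE => /orP[/eqP ->|/hW js]; first exact: subIsetl.
exact: subset_trans js.
Qed.

Variables (I : finType) (r : I -> ortho_rep R G).

Definition dsum_act (g : G) (x : dsum (fun i => r i)) : dsum (fun i => r i) :=
  fun i => act g (x i).

Let act1' x : dsum_act 1%g x = x.
Proof. by apply: functional_extensionality_dep => i; exact: act1. Qed.
Let actM' g h x : dsum_act (g * h)%g x = dsum_act g (dsum_act h x).
Proof. by apply: functional_extensionality_dep => i; exact: actM. Qed.
Let actD' g x y : dsum_act g (x + y) = dsum_act g x + dsum_act g y.
Proof. by apply: functional_extensionality_dep => i; exact: actD. Qed.
Let actZ' g a x : dsum_act g (a *: x) = a *: dsum_act g x.
Proof. by apply: functional_extensionality_dep => i; exact: actZ. Qed.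
Let act_ip' g x y : ip (dsum_act g x) (dsum_act g y) = ip x y.
Proof. by apply: eq_bigr => i _; exact: act_ip. Qed.
Let act_cont' (x : dsum (fun i => r i)) e : 0 < e -> exists2 U, open_subgroup U &
     forall u, U u -> q (dsum_act u x - x) < e.
Proof.
move=> e0.
have c0 : 0 < e / (#|I|.+1)%:R by rewrite divr_gt0.
have [U hU] := boolp.choice (fun i =>
  let: ex_intro2 V sV hV := act_cont (x i) c0 in
  ex_intro (fun V => open_subgroup V /\ forall u, V u ->
    q (act u (x i) - x i) < e / (#|I|.+1)%:R) V (conj sV hV)).
have [W sW hW] := osub_family (fun i => (hU i).1).
exists W => // u Wu.
apply: (@le_lt_trans _ _ (\sum_(i : I) e / (#|I|.+1)%:R)).
  by apply: ler_sum => i _; apply: ltW; apply: (hU i).2; exact: hW.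
by rewrite sumr_const -[_ / _ *+ _]mulr_natr mulrAC ltr_pdivrMr // ltr_pM2l // ltr_nat.
Qed.

Definition dsum_rep : ortho_rep R G := OrthoRep act1' actM' actD' actZ' act_ip' act_cont'.

End DirectSumRep.

(** * Independence *)

Section Independence.
Variables (R : realType) (G : topologicalGroupType).
Hypothesis rG : roelcke_precompact G.

(** Working in a direct sum makes the element v independent of the
    representation. *)
Lemma weak_mixing (I : finType) (r : I -> ortho_rep R G) (x y : forall i, r i)
    (V : set G) e : open_subgroup V ->
  (forall i, exists2 U, open_subgroup U & fix_by U (x i)) ->
  (forall i m, finite_orbit V m -> ip (x i) m = 0) -> 0 < e ->
  exists2 v, V v & forall i, `|ip (act v (x i)) (y i)| < e.
Proof.
move=> sV fx xo e0.
have [U hU] := boolp.choice (fun i =>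
  let: ex_intro2 U sU hU := fx i in
  ex_intro (fun U => open_subgroup U /\ fix_by U (x i)) U (conj sU hU)).
have [W sW hW] := osub_family (fun i => (hU i).1).
pose X : dsum_rep r := x.
have fX : fix_by W X.
  move=> w Ww; apply: functional_extensionality_dep => i.
  by apply: (hU i).2; exact: hW.
have XO (m : dsum_rep r) : finite_orbit V m -> ip X m = 0.
  move=> fm; apply: big1 => i _; apply: xo.
  apply: sub_finite_set (finite_image (fun z : dsum_rep r => z i) fm).
  by move=> _ [v Vv <-]; exists (act v m) => //; exists v.
(* The vector y i placed in the i-th summand. *)
pose Y i : dsum_rep r := fun j => (if i == j as b return (i == j) = b -> r j then
  fun ij => eq_rect i (fun j => r j) (y i) j (eqP ij) else fun=> 0) erefl.
have YE (z : dsum_rep r) i : ip z (Y i) = ip (z i) (y i).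
  rewrite /ip /= /dsum_ip (bigD1 i) //= big1 ?addr0.
    rewrite /Y; move: (erefl (i == i)); rewrite {2 3}eqxx => p.
    by rewrite (eq_irrelevance (eqP p) erefl).
  move=> j ji; rewrite /Y; move: (erefl (i == j)).
  by rewrite {2 3}eq_sym (negbTE ji) => p; rewrite ip0r.
have [v Vv hv] := weak_mixing1 rG sW sV fX XO [seq Y i | i <- enum I] e0.
exists v => // i; have := hv (Y i); rewrite subr0 YE; apply.
by apply: map_f; rewrite mem_enum.
Qed.

Lemma finite_reps (T : choiceType) (f : G -> T) (C : set G) :
  finite_set (f @` C) -> exists2 s : seq G, (forall c, c \in s -> C c) &
    forall c, C c -> exists2 c', c' \in s & f c' = f c.
Proof.
move=> /finite_seqP[s sE].
pose h t := xget 1%g [set c | C c /\ f c = t].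
have hP t : t \in s -> C (h t) /\ f (h t) = t.
  move=> ts; have [c Cc ct] : (f @` C) t by rewrite sE.
  by rewrite /h; case: xgetP => [c' -> //|/(_ c)]; case.
exists [seq h t | t <- s] => [_ /mapP[t /hP[Ch _] ->] //|c Cc].
have cs : f c \in s by have : (f @` C) (f c) by [exists c]; rewrite sE.
by exists (h (f c)); [exact: map_f | exact: (hP _ cs).2].
Qed.

Lemma finite_reps_family (I : finType) (T : I -> choiceType)
    (f : forall i, G -> T i) (C : set G) :
  (forall i, finite_set (f i @` C)) -> exists2 s : seq G, (forall c, c \in s -> C c) &
    forall i c, C c -> exists2 c', c' \in s & f i c' = f i c.
Proof.
move=> fC.
suff [s sC sP] : exists2 s : seq G, (forall c, c \in s -> C c) &
    forall i, i \in enum I -> forall c, C c -> exists2 c', c' \in s & f i c' = f i c.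
  by exists s => // i; apply: sP; rewrite mem_enum.
elim: (enum I) => [|i l [s sC sP]]; first by exists [::].
have [t tC tP] := finite_reps (fC i).
exists (t ++ s) => [c|j]; first by rewrite mem_cat => /orP[/tC|/sC].
rewrite inE => /orP[/eqP ->|jl] c Cc.
  by have [c' c't c'E] := tP c Cc; exists c' => //; rewrite mem_cat c't.
by have [c' c's c'E] := sP j jl c Cc; exists c' => //; rewrite mem_cat c's orbT.
Qed.

Lemma proj_self_adjoint (H : real_hilbert R) (M : set H) x y : subspace M ->
  ip (oproj M x) y = ip x (oproj M y).
Proof.
move=> Ms; rewrite -(@proj_ip _ _ M y (oproj M x)) //; last exact: proj_clos.
by rewrite ipC (proj_ip x Ms) ?(ipC x) //; exact: proj_clos.
Qed.

Lemma fix_conj (r : ortho_rep R G) (x : r) g U :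
  fix_by U x -> fix_by (conjset g U) (act g x).
Proof.
move=> fx u Uu; have := fx _ Uu; rewrite !actM => /(congr1 (act g)).
by rewrite actVK.
Qed.

(** Otherwise each of the finitely many double cosets D f C in V has a bad triple
    (a representation, x and y); weak mixing for the finitely many translates of
    these vectors by C and D gives an element of V in none of the double cosets. *)
Lemma independence (V C D : set G) : open_subgroup V -> open_subgroup C -> open_subgroup D ->
  C `<=` V -> D `<=` V ->
  exists2 v, V v & forall (r : ortho_rep R G) (x y : r), clos (finite_orbit C) x ->
    clos (finite_orbit D) y -> ip (act v (x - oproj (finite_orbit V) x)) y = 0.
Proof.
move=> sV sC sD CV DV.
suff [v Vv hv] : exists2 v, V v & forall (r : ortho_rep R G) (x y : r), finite_orbit C x ->
    finite_orbit D y -> ip (act v (x - oproj (finite_orbit V) x)) y = 0.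
  exists v => // r x y cx cy; have Vs := @subspace_fin _ _ r V.
  apply: orth_clos cy => m fm.
  have adj z : ip (act v (z - oproj (finite_orbit V) z)) m =
      ip (act (v^-1)%g m - oproj (finite_orbit V) (act (v^-1)%g m)) z.
    by rewrite act_ipl ipBl proj_self_adjoint // ipBl (ipC z) (ipC z) ipC.
  rewrite adj; apply: orth_clos cx => z fz; rewrite -adj; exact: hv.
apply: contrapT => nex.
have [s hs] := double_cosets rG (osubI sC sD).
pose s' := [seq f <- s | `[< V f >]].
have s'V f : f \in s' -> V f by rewrite mem_filter => /andP[/asboolP].
pose n := size s'; pose f (i : 'I_n) := nth 1%g s' i.
have fV i : V (f i) by apply: s'V; exact: mem_nth.
have bad i : exists d : {r : ortho_rep R G & (r * r)%type},
    let x := (projT2 d).1 in let y := (projT2 d).2 in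
    [/\ finite_orbit C x, finite_orbit D y &
        ip (act (f i) (x - oproj (finite_orbit V) x)) y = 1].
  apply: contrapT => nb; apply: nex; exists (f i) => // r x y fx fy.
  apply/eqP/negPn/negP => c0; set c := ip _ _ in c0; apply: nb.
  (* Normalising the coefficient to 1 gives a uniform bound for weak mixing. *)
  exists (existT _ r (x, c^-1 *: y)); split => //=.
    by have [_ _] := @subspace_fin _ _ r D; apply.
  by rewrite ipZr mulVf.
have [d dP] := boolp.choice bad.
pose r i := projT1 (d i); pose x i : r i := (projT2 (d i)).1.
pose y i : r i := (projT2 (d i)).2.
have fx i : finite_orbit C (x i) by case: (dP i).
have fy i : finite_orbit D (y i) by case: (dP i).
have fxy i : ip (act (f i) (x i - oproj (finite_orbit V) (x i))) (y i) = 1 by case: (dP i).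
pose x' i := x i - oproj (finite_orbit V) (x i).
have [cs csC csP] := @finite_reps_family _ r (fun i c => act c (x i)) C fx.
have [ds dsD dsP] := @finite_reps_family _ r (fun i c => act c (y i)) D fy.
have ax' i c : C c -> act c (x' i) = act c (x i) - oproj (finite_orbit V) (act c (x i)).
  by move=> /CV Vc; rewrite actB act_proj_fin_in.
have [||v Vv hv] := @weak_mixing _ (fun j : 'I_n * 'I_(size cs) * 'I_(size ds) => r j.1.1)
  (fun j => act (nth 1%g cs j.1.2) (x' j.1.1)) (fun j => act (nth 1%g ds j.2) (y j.1.1))
  V 1 sV _ _ ltr01.
- move=> [[i j] k] /=.
  have [U [sU UC] fU] := fin_fix_open sC (fx i).
  exists (conjset (nth 1%g cs j) U); first exact: osub_conj.
  apply: fix_conj => u Uu; rewrite actB act_proj_fin_in ?fU //.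
  exact/CV/UC.
- move=> [[i j] k] m fm /=; rewrite act_ipl proj_orth //; first exact: subspace_fin.
  apply: sub_clos; apply: fin_act => //; apply: osubV => //.
  by apply/CV/csC; exact: mem_nth.
have [u [e [w [[Cu Du] es [Cw Dw] vE]]]] := hs v.
have es' : e \in s'.
  rewrite mem_filter es andbT; apply/asboolP.
  have -> : e = (u^-1 * v / w)%g by rewrite vE !mulgA mulVg mul1g mulgK.
  by apply: osubF => //; [apply: osubM => //; apply: osubV => //|]; exact: CV.
have ei : (index e s' < n)%N by rewrite index_mem.
pose i := Ordinal ei.
have [c' c'cs c'E] := csP i _ (osubV sC Cw).
have [d' d'ds d'E] := dsP i _ Du.
have jc : (index c' cs < size cs)%N by rewrite index_mem.
have kd : (index d' ds < size ds)%N by rewrite index_mem.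
have := hv (i, Ordinal jc, Ordinal kd) => /=.
rewrite !nth_index // d'E ax'; last exact: csC.
rewrite c'E -ax'; last exact: osubV.
have fi : f i = e by rewrite /f /= nth_index.
by rewrite vE -actM mulgK actM act_ip -fi fxy normr1 ltxx.
Qed.

End Independence.

(** * Completeness arguments in non-archimedean groups *)

Section Complete.
Variables (R : realType) (G : topologicalGroupType) (d : G -> G -> R).
Hypotheses (na : non_archimedean G) (dm : is_metric d)
  (dt : metric_induces_topology d) (dc : complete_metric d).
Implicit Types (A B U V W : set G) (x y g h p : G).

Lemma distC x y : d x y = d y x. Proof. by case: dm => _ + _; apply. Qed.
Lemma dist_tri x y z : d x z <= d x y + d y z.
Proof. by case: dm => _ _; apply. Qed.

Lemma small_coset x e : 0 < e ->
  exists2 U, open_subgroup U & forall u, U u -> d x (x * u)%g < e.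
Proof.
move=> e0; apply: (nonarch_nbhs na (A := [set u | d x (x * u)%g < e])).
apply: (@mulgl_continuous _ x 1%g [set y | d x y < e]); rewrite mulg1.
by apply/dt; exists e.
Qed.

Lemma cauchy_lim (u : nat -> G) :
  (forall e, 0 < e -> exists N, forall n, (N <= n)%N -> d (u N) (u n) < e) ->
  exists l, forall e, 0 < e -> exists N, forall n, (N <= n)%N -> d l (u n) < e.
Proof.
move=> cu; have [|l hl] := dc (u := u).
  move=> e e0; have [|N hN] := cu (e / 2); first by lra.
  exists N => m n /hN hm /hN hn.
  by have := dist_tri (u m) (u N) (u n); rewrite (distC (u m) (u N)); lra.
exists l => e e0; have /hl : nbhs l [set y | d l y < e] by apply/dt; exists e.
by case=> N _ hN; exists N => n Nn; apply: hN.
Qed.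

Lemma osub_base W : open_subgroup W -> exists N, forall n, (N <= n)%N ->
  [set u | d 1%g u < n.+1%:R^-1] `<=` W.
Proof.
move=> /osub_nbhs/dt[e e0 he]; have [N hN] := inv_small e0; exists N => n /hN ne u /= hu.
by apply: he => /=; exact: lt_trans ne.
Qed.

Lemma ultra_finite_union (T : Type) (E : eqType) (F : set_system T) (s : seq E)
    (D : E -> set T) : UltraFilter F -> F [set p | exists2 e, e \in s & D e p] ->
  exists2 e, e \in s & F (D e).
Proof.
move=> UF; elim: s => [|a s IH] h.
  by have [p [e]] := filter_ex h.
have [Fa|nFa] := in_ultra_setVsetC (D a) UF; first by exists a => //; rewrite inE eqxx.
have [e es Fe] : exists2 e, e \in s & F (D e).
  apply: IH; apply: filterS (filterI h nFa) => p [[e + De] nDa].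
  by rewrite inE => /orP[/eqP ea|es]; [rewrite ea in De | exists e].
by exists e => //; rewrite inE es orbT.
Qed.

(** Being, at every scale, in a finite union of small cosets means being totally
    bounded, and such a set is closed. *)
Lemma compact_cosets (P : nat -> seq (G * set G)) :
  (forall n e, e \in P n -> open_subgroup e.2) ->
  (forall n e u, e \in P n -> e.2 u -> d e.1 (e.1 * u)%g < n.+1%:R^-1) ->
  compact [set p | forall n, exists2 e, e \in P n & e.2 (e.1^-1 * p)%g].
Proof.
move=> sP dP; rewrite compact_ultra => F UF FC; have PF := @ultra_proper _ _ UF.
have hn n : exists e, e \in P n /\ F [set p | e.2 (e.1^-1 * p)%g].
  have [|e eP Fe] := @ultra_finite_union _ _ F (P n)
    (fun e => [set p | e.2 (e.1^-1 * p)%g]) UF; last by exists e.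
  by apply: filterS FC => p; apply.
have [c cP] := boolp.choice hn.
have near n p : (c n).2 ((c n).1^-1 * p)%g -> d (c n).1 p < n.+1%:R^-1.
  by move=> /(dP n _ _ (cP n).1); rewrite mulVKg.
have [|l hl] := @cauchy_lim (fun n => (c n).1).
  move=> e e0; have [|N hN] := @inv_small R (e / 2); first by lra.
  exists N => n /hN h2; have h1 := hN N (leqnn N).
  have [p [/= /near p1 /near p2]] := filter_ex (filterI (cP N).2 (cP n).2).
  have := dist_tri (c N).1 p (c n).1; rewrite (distC p).
  by move: (lt_trans p1 h1) (lt_trans p2 h2); lra.
have Fl : F --> l.
  move=> W /dt[e e0 heW].
  have [|N hN] := hl (e / 2); first by lra.
  have [|M hM] := @inv_small R (e / 2); first by lra.
  have h1 := hN _ (leq_maxl N M); have h2 := hM _ (leq_maxr N M).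
  apply: filterS (cP (maxn N M)).2 => p /= /near hp; apply: heW => /=.
  by have := dist_tri l (c (maxn N M)).1 p; move: (lt_trans hp h2); lra.
exists l; split=> // n; exists (c n); first exact: (cP n).1.
have sA := sP n _ (cP n).1.
have : nbhs l [set p | (c n).2 (l^-1 * p)%g].
  apply: open_nbhs_nbhs; split; first exact: open_lcoset sA.1.
  by rewrite /= mulVg; exact: osub1.
move=> /Fl Fn; have [p [/= h1 h2]] := filter_ex (filterI (cP n).2 Fn).
by have := osubF sA h1 h2; rewrite invgM invgK mulgA mulgK.
Qed.

(** ** Zigzag construction *)

Section ZigZag.
Variables (T : Type) (Phi : T -> bool -> G -> G -> set G -> Prop).
Hypothesis step : forall b x y A B, open_subgroup A -> open_subgroup B -> A `<=` B ->
  exists2 Y : seq G, (forall y', y' \in Y -> B (y^-1 * y')%g) &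
    forall t, Phi t b x y B -> exists2 y', y' \in Y & Phi t (~~ b) y' x A.

(** The metric d need not be invariant, so a neighbourhood x A can only be made
    small once x is known.  Two sequences are therefore built alternately: each
    new term is constrained by a coset of a subgroup chosen after the term two
    steps before it.  The choices at each step range over a finite set that serves
    all t, so that the limits for varying t stay in compact sets. *)
Lemma uniform_zigzag x0 y0 B0 : open_subgroup B0 -> exists C1 C2 : set G,
  [/\ compact C1, compact C2 & forall t, Phi t true x0 y0 B0 ->
    exists p h, [/\ C1 p, C2 h & forall U, open_subgroup U -> exists x y B,
      [/\ Phi t true x y B, U (p^-1 * x)%g, U (h^-1 * y)%g & B `<=` U]]].
Proof.
move=> sB0; pose state := (bool * G * G * set G)%type.
have small (z : G * set G * nat) : exists A, open_subgroup z.1.2 ->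
    [/\ open_subgroup A, A `<=` z.1.2,
    (forall u, A u -> d z.1.1 (z.1.1 * u)%g < z.2.+1%:R^-1) &
    A `<=` [set u | d 1%g u < z.2.+1%:R^-1]].
  case: z => [[x B] n] /=; have n0 : 0 < n.+1%:R^-1 :> R by rewrite invr_gt0.
  have [U sU hU] := small_coset x n0; have [V sV hV] := small_coset 1%g n0.
  exists (B `&` U `&` V) => sB; split.
  - by apply: osubI => //; exact: osubI.
  - by move=> u [[]].
  - by move=> u [[_ Uu] _]; exact: hU.
  - by move=> u [_ Vu] /=; rewrite -[u]mul1g; exact: hV.
have [Af AfP] := boolp.choice small.
have next (z : state * set G) : exists Y : seq G, open_subgroup z.2 -> open_subgroup z.1.2 ->
    z.2 `<=` z.1.2 -> (forall y', y' \in Y -> z.1.2 (z.1.1.2^-1 * y')%g) /\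
    forall t, Phi t z.1.1.1.1 z.1.1.1.2 z.1.1.2 z.1.2 ->
      exists2 y', y' \in Y & Phi t (~~ z.1.1.1.1) y' z.1.1.1.2 z.2.
  case: z => [[[[b x] y] B] A] /=.
  have [[sA sB AB]|n] := pselect [/\ open_subgroup A, open_subgroup B & A `<=` B].
    by have [Y h1 h2] := step b x y sA sB AB; exists Y.
  by exists [::] => sA sB AB; case: n.
have [Yf YfP] := boolp.choice next.
(* In a state (b, x, y, B) the coset y B constrains the next term; A is the small
   subgroup chosen for x, which constrains the term after it. *)
pose As (s : state) n := Af (s.1.1.2, s.2, n).
pose kids (s : state) n : seq state :=
  [seq (~~ s.1.1.1, y', s.1.1.2, As s n) | y' <- Yf (s, As s n)].
pose fix L n : seq state :=
  if n is m.+1 then flatten [seq kids s m | s <- L m] else [:: (true, x0, y0, B0)].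
have sAs s n : open_subgroup s.2 -> [/\ open_subgroup (As s n), As s n `<=` s.2,
    (forall u, As s n u -> d s.1.1.2 (s.1.1.2 * u)%g < n.+1%:R^-1) &
    As s n `<=` [set u | d 1%g u < n.+1%:R^-1]].
  exact: (AfP (s.1.1.2, s.2, n)).
have sL n s : s \in L n -> open_subgroup s.2.
  elim: n s => [|n IH] s /=; first by rewrite inE => /eqP ->.
  move=> /flattenP[_ /mapP[s' /IH sB' ->] /mapP[y' _ ->]] /=.
  by have [] := sAs s' n sB'.
pose P k n := [seq (s.1.1.2, As s (2 * n + k)%N) | s <- L (2 * n + k)%N].
pose Cs k := [set p | forall n, exists2 e, e \in P k n & e.2 (e.1^-1 * p)%g].
have cP k : compact (Cs k).
  apply: compact_cosets => [n e|n e u] /mapP[s sLn ->] /=.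
    by have [] := sAs s (2 * n + k)%N (sL _ _ sLn).
  have [_ _ + _] := sAs s (2 * n + k)%N (sL _ _ sLn) => /[apply] h.
  apply: lt_le_trans h _; rewrite lef_pV2 ?posrE ?ltr0Sn // ler_nat ltnS.
  by rewrite mul2n -addnn -addnA leq_addr.
exists (Cs 0%N), (Cs 1%N); split; [exact: cP | exact: cP | move=> t Phi0].
pose good (s : state) := Phi t s.1.1.1 s.1.1.2 s.1.2 s.2.
have nxt (z : state * nat) : exists s', open_subgroup z.1.2 -> good z.1 ->
    s' \in kids z.1 z.2 /\ good s'.
  case: z => s n /=.
  have [[sB gs]|ng] := pselect (open_subgroup s.2 /\ good s); last first.
    by exists s => sB gs; case: ng.
  have [sA AB _ _] := sAs s n sB.
  have [_ /(_ t gs)[y' y'Y gy']] := YfP (s, As s n) sA sB AB.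
  by exists (~~ s.1.1.1, y', s.1.1.2, As s n) => _ _; split=> //; apply: map_f.
have [nf nfP] := boolp.choice nxt.
pose fix S n : state := if n is m.+1 then nf (S m, m) else (true, x0, y0, B0).
have SP n : S n \in L n /\ good (S n).
  elim: n => [|n [IH1 IH2]]; first by rewrite /= inE eqxx.
  have [h1 h2] := nfP (S n, n) (sL _ _ IH1) IH2; split=> //.
  by apply/flattenP; exists (kids (S n) n) => //; apply: map_f.
have SB n : open_subgroup (S n).2 by exact: sL (SP n).1.
have SS n : S n.+1 \in kids (S n) n by have [] := nfP (S n, n) (SB n) (SP n).2.
pose X n := (S n).1.1.2; pose A n := As (S n) n.
have sA n : open_subgroup (A n) by have [] := sAs (S n) n (SB n).
have AB n : A n `<=` (S n).2 by have [] := sAs (S n) n (SB n).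
have dA n u : A n u -> d (X n) (X n * u)%g < n.+1%:R^-1.
  by have [_ _ + _] := sAs (S n) n (SB n); apply.
have A1 n : A n `<=` [set u | d 1%g u < n.+1%:R^-1].
  by have [_ _ _] := sAs (S n) n (SB n); apply.
have S2 n : (S n.+1).2 = A n by have /mapP[y' _ ->] := SS n.
have Sy n : (S n.+1).1.2 = X n by have /mapP[y' _ ->] := SS n.
have Sb n : (S n.+1).1.1.1 = ~~ (S n).1.1.1 by have /mapP[y' _ ->] := SS n.
have XS n : (S n).2 ((S n).1.2^-1 * X n.+1)%g.
  have := SS n => /mapP[y' y'Y XE].
  have [+ _] := YfP (S n, As (S n) n) (sA n) (SB n) (AB n).
  by move=> /(_ y' y'Y); rewrite /X XE.
have Adec n : A n.+1 `<=` A n by move=> u /AB; rewrite S2.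
have Xstep n : A n ((X n)^-1 * X n.+2)%g by have := XS n.+1; rewrite S2 Sy.
have Adecr n m : A (n + m)%N `<=` A n.
  by elim: m => [|m IH]; rewrite ?addn0 // addnS; exact: subset_trans (Adec _) IH.
have Xn n k : A n ((X n)^-1 * X (n + 2 * k)%N)%g.
  elim: k => [|k IH]; first by rewrite muln0 addn0 mulVg; exact: osub1.
  have := osubM (sA n) IH (@Adecr n (2 * k)%N _ (Xstep _)).
  by rewrite mulgA mulgK mulnS addnCA -addn2 addnC.
have lim k : exists p, forall n, A (2 * n + k)%N ((X (2 * n + k)%N)^-1 * p)%g.
  have [|p hp] := @cauchy_lim (fun n => X (2 * n + k)%N).
    move=> e e0; have [N hN] := inv_small e0; exists N => n Nn.
    have := Xn (2 * N + k)%N (n - N)%N.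
    rewrite addnAC -mulnDr subnKC // => /dA; rewrite mulVKg => h.
    apply: lt_trans h _; apply: hN.
    by rewrite mul2n -addnn -addnA leq_addr.
  exists p => n; set m := (2 * n + k)%N.
  have : nbhs p [set z | A m (p^-1 * z)%g].
    apply: open_nbhs_nbhs; split; first exact: open_lcoset (sA m).1.
    by rewrite /= mulVg; exact: osub1.
  move=> /dt[e e0 he]; have [N hN] := hp e e0.
  have /he /= h1 : d p (X (2 * (n + N) + k)%N) < e by apply: hN; exact: leq_addl.
  have := Xn m N; rewrite /m addnAC -mulnDr => h2.
  by have := osubF (sA m) h2 h1; rewrite invgM invgK mulgA mulgK.
have [p hp] := lim 0%N; have [h hh] := lim 1%N.
have inC k z : (forall n, A (2 * n + k)%N ((X (2 * n + k)%N)^-1 * z)%g) ->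
    forall n, exists2 e, e \in P k n & e.2 (e.1^-1 * z)%g.
  move=> hz n; exists (X (2 * n + k)%N, A (2 * n + k)%N); last exact: hz.
  by apply: (map_f (fun s => (s.1.1.2, As s (2 * n + k)%N))); exact: (SP _).1.
exists p, h; split; [exact: inC | exact: inC | move=> U sU].
have [N hN] := osub_base sU.
have Seven n : (S (2 * n)%N).1.1.1 = true.
  by elim: n => // n IH; rewrite mulnS !Sb IH.
pose m := (2 * N.+1)%N.
exists (X m), (S m).1.2, (S m).2; split.
- by have := (SP m).2; rewrite /good Seven.
- have := hp N.+1; rewrite addn0 -/m => /(osubV (sA m)); rewrite invgM invgK.
  move=> /A1; apply: hN; rewrite /m; lia.
- have -> : m = (2 * N + 1).+1 by rewrite /m; lia.
  rewrite Sy; have := hh N => /(osubV (sA _)); rewrite invgM invgK.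
  move=> /A1; apply: hN; lia.
- have -> : m = (2 * N + 1).+1 by rewrite /m; lia.
  rewrite S2 => u /A1; apply: hN; lia.
Qed.

End ZigZag.

Lemma zigzag (Phi : bool -> G -> G -> set G -> Prop) x0 y0 B0 :
  (forall b x y A B, open_subgroup A -> open_subgroup B -> A `<=` B -> Phi b x y B ->
    exists2 y', B (y^-1 * y')%g & Phi (~~ b) y' x A) ->
  open_subgroup B0 -> Phi true x0 y0 B0 ->
  exists p h, forall U, open_subgroup U -> exists x y B,
    [/\ Phi true x y B, U (p^-1 * x)%g, U (h^-1 * y)%g & B `<=` U].
Proof.
move=> step sB0 Phi0.
have [|C1 [C2 [_ _ /(_ tt Phi0)[p [h [_ _ hph]]]]]] :=
  @uniform_zigzag unit (fun=> Phi) _ x0 y0 _ sB0; last by exists p, h.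
move=> b x y A B sA sB AB.
have [/(step _ _ _ _ _ sA sB AB)[y' By' Py']|nPhi] := pselect (Phi b x y B).
  exists [:: y'] => [z|_ _]; first by rewrite inE => /eqP ->.
  by exists y' => //; rewrite inE.
by exists [::].
Qed.

(** The sequence a need not be Cauchy for d, only for the two-sided uniformity.
    The zigzag builds sequences x and y, both convergent for d, with a x close to
    y; the limit of a is then the quotient of their limits. *)
Lemma two_sided_complete (a : nat -> G) :
  (forall U, open_subgroup U -> exists N, forall m n, (N <= m)%N -> (N <= n)%N ->
     U ((a m)^-1 * a n)%g /\ U (a m / a n)%g) ->
  exists l, forall W, open_subgroup W -> exists N, forall n, (N <= n)%N -> W (l^-1 * a n)%g.
Proof.
move=> ca.
pose a' (b : bool) m := if b then a m else ((a m)^-1)%g.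
have ca' b U : open_subgroup U -> exists N, forall m n, (N <= m)%N -> (N <= n)%N ->
    U ((a' b m)^-1 * a' b n)%g.
  move=> sU; have [N hN] := ca U sU; exists N => m n Nm Nn.
  by case: b; rewrite /a' ?invgK; have [] := hN m n Nm Nn.
pose Phi b x y B := exists N, forall m, (N <= m)%N -> B (y^-1 * (a' b m * x))%g.
have [|||p [h hph]] := @zigzag Phi 1%g 1%g setT.
- move=> b x y A B sA sB AB [N hN].
  have [M hM] := ca' b _ (osub_conj x sA).
  exists (a' b (maxn N M) * x)%g; first by apply: hN; exact: leq_maxl.
  exists (maxn N M) => m hm.
  have := hM m (maxn N M) (leq_trans (leq_maxr _ _) hm) (leq_maxr _ _).
  by rewrite /conjset /=; case: b {hN hM}; rewrite /= ?invgK !mulgA.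
- exact: osubT.
- by exists 0%N.
exists (h / p)%g => W sW.
have sU := osub_conj (p^-1)%g sW.
have [x [y [B [[N hN] px hy BU]]]] := hph _ sU.
exists N => n /hN/BU hn.
have := osubF sU (osubM sU hy hn) px.
by rewrite /conjset /= !invgM !invgK !mulgA !mulgK.
Qed.

End Complete.

(** * Finite index *)

Section FiniteIndex.
Variable G : topologicalGroupType.
Implicit Types (A V W N : set G) (g : G).

Definition lcoset_reps V (s : seq G) := forall g, exists2 f, f \in s & V (f^-1 * g)%g.

Lemma finite_indexP V : group_closed [in V] -> finite_index V <-> exists s, lcoset_reps V s.
Proof.
move=> /group_closedP[V1 VF].
have VV x : V x -> V (x^-1)%g by move=> Vx; rewrite -div1g; exact: VF.
have VM x y : V x -> V y -> V (x * y)%g.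
  by move=> Vx Vy; rewrite -(invgK y); apply: VF => //; exact: VV.
split=> [fV|[s hs]].
  have [s _ hs] := @finite_reps G _ (fun g => [set (g * v)%g | v in V]) setT fV.
  exists s => g; have [f fs fE] := hs g I; exists f => //.
  have : [set (f * v)%g | v in V] g by rewrite fE; exists 1%g; rewrite ?mulg1.
  by case=> v Vv <-; rewrite mulKg.
apply: sub_finite_set (finite_image (fun g => [set (g * v)%g | v in V]) (finite_seq s)).
move=> _ [g _ <-]; have [f fs Vfg] := hs g; exists f => //.
apply/seteqP; split=> _ [v Vv <-].
  exists ((f^-1 * g)^-1 * v)%g; first by apply: VM => //; exact: VV.
  by rewrite invgM invgK !mulgA mulgV mul1g.
by exists ((f^-1 * g) * v)%g; [exact: VM | rewrite !mulgA mulgV mul1g].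
Qed.
End FiniteIndex.

(** * The free pair *)

Section FreePair.
Variables (R : realType) (G : topologicalGroupType) (d : G -> G -> R).
Hypotheses (na : non_archimedean G) (rG : roelcke_precompact G)
  (dm : is_metric d) (dt : metric_induces_topology d) (dc : complete_metric d).
Implicit Types (A S U V W : set G) (a g : G).

(** The space of vectors with finite U-orbit is written H(U).  Let E be the part
    of H(V') orthogonal to H(V).  After a forward step (b = true) a maps E off
    H(S); after a backward step E itself is off H(S), which says that a^-1 maps the
    part of H(a V' a^-1) orthogonal to H(a V a^-1) off H(S). *)
Definition moved_off (b : bool) a V V' S := forall (r : ortho_rep R G) (x y : r),
  clos (finite_orbit V') x -> clos (finite_orbit S) y ->
  let z := x - oproj (finite_orbit V) x in ip (if b then act a z else z) y = 0.

(** One step of the construction, from the approximation a V to the smaller coset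
    a' V'.  The subgroup U is small and is imposed on the domain in a forward step,
    on the range in a backward step; S' is made small enough to see the whole of
    the new domain and range. *)
Definition extension (b : bool) U a V S (t : G * set G * set G) :=
  let: (a', V', S') := t in
  [/\ [/\ open_subgroup V', open_subgroup S' & V' `<=` V],
      V (a^-1 * a')%g /\ (if b then V' else conjset a' V') `<=` U,
      [/\ S' `<=` S, S' `<=` V' & S' `<=` conjset a' V'] & moved_off b a' V V' S].

(** The element a' = v a, where v comes from independence over a V a^-1. *)
Lemma extend_forward U a V S : open_subgroup U -> open_subgroup V -> open_subgroup S ->
  exists t, extension true U a V S t.
Proof.
move=> sU sV sS; pose V' := V `&` U; have sV' : open_subgroup V' by exact: osubI.
have sR := osub_conj a sV; have sC := osub_conj a sV'.
have [||v Rv hv] := independence R rG sR sC (osubI sS sR).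
- by apply: conj_sub => u [].
- by move=> u [].
exists ((v * a)%g, V', S `&` V' `&` conjset (v * a)%g V'); split.
- by split=> //; [do 2!apply: osubI => //; exact: osub_conj | move=> u []].
- by split=> [|u []//]; move: Rv; rewrite /conjset /= !mulgA.
- by split=> u [[]].
- move=> r x y cx cy /=; rewrite actM actB act_proj_fin; apply: hv.
    by apply: act_clos cx => m; exact: fin_conj.
  by apply: clos_sub cy; apply: fin_sub => u [].
Qed.

(** A forward step for a^-1, with domain and range exchanged. *)
Lemma extend_backward U a V S : open_subgroup U -> open_subgroup V -> open_subgroup S ->
  exists t, extension false U a V S t.
Proof.
move=> sU sV sS; have sR := osub_conj a sV.
have [[[b R'] S'] [[sR' sS' R'R] [Rab R'U] [S'S S'R' S'bR'] mo]] :=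
  extend_forward (a^-1)%g sU sR sS.
have Vba : V (b * a)%g by move: Rab; rewrite /conjset /= invgK !mulgA mulVg mul1g.
have bR : conjset b (conjset a V) = V by rewrite -conj_mul conj_id.
exists ((b^-1)%g, conjset b R', S'); rewrite /extension conjK; split.
- by split=> //; [exact: osub_conj | rewrite -bR; exact: conj_sub].
- by split=> //; rewrite -invgM; exact: osubV.
- by [].
- move=> r x y cx cy /=.
  have := mo r (act (b^-1)%g x) y _ cy; rewrite /= actB act_proj_fin bR actVK.
  by apply; apply: act_clos cx => m /(fin_conj (b^-1)%g); rewrite conjK.
Qed.

Lemma extend b U a V S : open_subgroup U -> open_subgroup V -> open_subgroup S ->
  exists t, extension b U a V S t.
Proof. by case: b; [exact: extend_forward | exact: extend_backward]. Qed.

(** Back and forth: forward steps make the domain V of the approximation of l i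
    small, backward steps make its range l i V (l i)^-1 small. *)
Lemma free_pair : exists (l : bool -> G) (V : nat -> bool -> set G) (S : nat -> set G),
  [/\ [/\ forall i, V 0%N i = setT, forall k i, open_subgroup (V k i) &
          forall k, open_subgroup (S k)],
      [/\ forall k i, V k.+1 i `<=` V k i, forall k, S k.+1 `<=` S k,
          forall k i, S k `<=` V k i & forall k i, S k `<=` conjset (l i) (V k i)],
      forall k i, i != odd k -> V k.+1 i = V k i,
      forall k, moved_off (odd k./2) (l (odd k)) (V k (odd k)) (V k.+1 (odd k)) (S k)
    & forall i W, open_subgroup W -> exists K, forall k, (K <= k)%N -> V k i `<=` W].
Proof.
have ball n : exists U, open_subgroup U /\ U `<=` [set u | d 1%g u < n.+1%:R^-1].
  have [|U sU hU] := small_coset na dt 1%g (e := n.+1%:R^-1).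
    by rewrite invr_gt0 ltr0Sn.
  by exists U; split=> // u /hU; rewrite mul1g.
have [U hU] := boolp.choice ball.
pose state := ((bool -> G) * (bool -> set G) * set G)%type.
pose inv (s : state) := (forall i, open_subgroup (s.1.2 i)) /\ [/\ open_subgroup s.2,
  forall i, s.2 `<=` s.1.2 i & forall i, s.2 `<=` conjset (s.1.1 i) (s.1.2 i)].
pose rel k (s t : state) := [/\ inv t,
  forall i, i != odd k -> t.1.1 i = s.1.1 i /\ t.1.2 i = s.1.2 i &
  extension (odd k./2) (U k) (s.1.1 (odd k)) (s.1.2 (odd k)) s.2
    (t.1.1 (odd k), t.1.2 (odd k), t.2)].
have nxt (z : state * nat) : exists t, inv z.1 -> rel z.2 z.1 t.
  case: z => [[[g V] S] k] /=.
  have [[sV [sS SV ScV]]|n] := pselect (inv (g, V, S)); last by exists (g, V, S) => ?; case: n.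
  have [[[a' V'] S'] ext] := extend (odd k./2) (g (odd k)) (hU k).1 (sV (odd k)) sS.
  have [[sV' sS' V'V] [Va' _] [S'S S'V' S'a'] _] := ext.
  exists (fun i => if i == odd k then a' else g i,
          fun i => if i == odd k then V' else V i, S') => _; split => /=.
  - split=> [i|]; first by rewrite /=; case: (i == odd k); [exact: sV' | exact: sV].
    split=> //= i; case: (i == odd k) => //.
      exact: (subset_trans S'S (SV i)).
    exact: (subset_trans S'S (ScV i)).
  - by move=> i /negbTE ->.
  - by rewrite !eqxx.
have [nf nfP] := boolp.choice nxt.
pose s0 : state := (fun=> 1%g, fun=> setT, setT).
pose fix st n : state := if n is m.+1 then nf (st m, m) else s0.
have stI n : inv (st n).
  elim: n => [|n IH]; last by have [] := nfP (st n, n) IH.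
  by split=> [i|]; [exact: osubT | split=> //; exact: osubT].
have stR n : rel n (st n) (st n.+1) by exact: (nfP (st n, n) (stI n)).
pose a n := (st n).1.1; pose V n := (st n).1.2; pose S n := (st n).2.
have sV n i : open_subgroup (V n i) by exact: (stI n).1.
have sS n : open_subgroup (S n) by have [_ []] := stI n.
have stay k i : i != odd k -> a k.+1 i = a k i /\ V k.+1 i = V k i.
  by move=> ik; have [_ /(_ i ik)] := stR k.
have ext k : extension (odd k./2) (U k) (a k (odd k)) (V k (odd k)) (S k)
    (a k.+1 (odd k), V k.+1 (odd k), S k.+1) by have [] := stR k.
have Vdec k i : V k.+1 i `<=` V k i.
  have [->|/stay[_ ->//]] := eqVneq i (odd k).
  by have [[]] := ext k.
have Sdec k : S k.+1 `<=` S k by have [_ _ []] := ext k.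
have aV k i : V k i ((a k i)^-1 * a k.+1 i)%g.
  have [->|/stay[-> _]] := eqVneq i (odd k); first by have [_ []] := ext k.
  by rewrite mulVg; exact: osub1.
have Vdecm i k m : (k <= m)%N -> V m i `<=` V k i.
  move=> /subnKC <-; elim: (m - k)%N => [|n IH]; first by rewrite addn0.
  by rewrite addnS; exact: subset_trans (Vdec _ _) IH.
have aVm i k m : (k <= m)%N -> V k i ((a k i)^-1 * a m i)%g.
  move=> /subnKC <-; elim: (m - k)%N => [|n IH].
    by rewrite addn0 mulVg; exact: osub1.
  have := osubM (sV k i) IH (Vdecm i k _ (leq_addr n k) _ (aV (k + n)%N i)).
  by rewrite addnS !mulgA mulgK.
have fit i b W : open_subgroup W -> exists k,
    (if b then V k i else conjset (a k i) (V k i)) `<=` W.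
  move=> sW; have [N hN] := osub_base dt sW.
  (* Step k treats the generator odd k in the direction odd k./2. *)
  pose k := (4 * N + 2 * b + i)%N.
  have ok : odd k = i by rewrite /k oddD oddD oddM oddM; case: (i).
  have ok2 : odd k./2 = b.
    have -> : (k./2 = 2 * N + b)%N by rewrite /k; case: (b); case: (i); lia.
    by rewrite oddD oddM; case: (b).
  exists k.+1; have [_ [_ h] _ _] := ext k; rewrite ok ok2 in h.
  apply: subset_trans h _; apply: subset_trans (hU k).2 _.
  by apply: hN; rewrite /k; lia.
have lim i : exists l, forall k, V k i ((a k i)^-1 * l)%g.
  have [|l hl] := two_sided_complete na dm dt dc (a := a^~ i).
    move=> W sW; have [k hk] := fit i true W sW; have [j hj] := fit i false W sW.
    exists (maxn k j) => m n; rewrite !geq_max => /andP[km jm] /andP[kn jn]; split.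
      apply: hk; have := osubM (sV k i) (osubV (sV k i) (aVm i k m km)) (aVm i k n kn).
      by rewrite invgM invgK !mulgA mulgK.
    apply: hj; rewrite /conjset /=.
    have := osubF (sV j i) (aVm i j m jm) (aVm i j n jn).
    by rewrite invgM invgK !mulgA.
  exists l => k; have [N hN] := hl _ (sV k i).
  have := osubF (sV k i) (aVm i k _ (leq_maxr N k)) (hN _ (leq_maxl N k)).
  by rewrite invgM invgK !mulgA mulgK.
have [l hl] := boolp.choice lim.
have lE k i : conjset (l i) (V k i) = conjset (a k i) (V k i).
  by rewrite -[l i](mulVKg (a k i)) conjM_in.
exists l, V, S; split.
- by [].
- split=> // k i; have [_ [_ h1 h2]] := stI k; first exact: h1.
  by rewrite lE; exact: h2.
- by move=> k i /stay[].
- move=> k r x y cx cy /=; set i := odd k in cx *.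
  have [_ _ _ mo] := ext k; rewrite -/i in mo.
  case E: (odd k./2) mo => mo; last exact: mo.
  pose u := ((a k.+1 i)^-1 * l i)%g; have Vu : V k.+1 i u := hl i k.+1.
  have -> : l i = (a k.+1 i * u)%g by rewrite mulVKg.
  rewrite actM actB act_proj_fin_in //; last exact: Vdec Vu.
  by apply: mo => //; apply: act_clos cx => m; exact: fin_act.
- move=> i W sW; have [K hK] := fit i true W sW; exists K => k Kk.
  exact: subset_trans (Vdecm i _ _ Kk) hK.
Qed.

(** ** The spectral gap *)

Lemma q_proj_incr (H : real_hilbert R) (M N : set H) x : subspace M -> subspace N ->
  M `<=` N -> q (oproj N x) = q (oproj M x) + q (oproj N x - oproj M x).
Proof.
move=> Ms Ns MN; rewrite qB (ipC (oproj N x)) proj_ip -?q_proj //; first by ring.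
exact: clos_sub MN _ (proj_clos x Ms).
Qed.

Lemma q_near_le (H : real_hilbert R) (M : set H) x m : subspace M -> clos M m ->
  q (x - oproj M x) <= q (x - m).
Proof.
move=> Ms cm; have cp := proj_clos x Ms.
have -> : x - m = (x - oproj M x) + (oproj M x - m) by rewrite addrA subrK.
rewrite (qD (x - oproj M x)) proj_orth //; last exact: subspaceB (clos_subspace Ms) cp cm.
by have := q_ge0 (oproj M x - m); lra.
Qed.

(** Each increment of the projections of x on the domains of l i is orthogonal to
    earlier vectors after applying l i (forward step) or as it stands (backward
    step), so it is dominated by the corresponding increment of the projections
    of l i x, respectively x, on the spaces of S.  The steps for the two l i are
    disjoint: the two families of increments, each with total mass q x, compete
    for the mass q x. *)
Lemma spectral_gap : exists l : bool -> G, forall (r : ortho_rep R G) (x : r),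
  (forall m, finite_orbit setT m -> ip x m = 0) ->
  q x <= 6 * (q (act (l true) x - x) + q (act (l false) x - x)).
Proof.
have [l [V [S [[V0 sV sS] [Vdec Sdec SV SlV] stay mo small]]]] := free_pair.
exists l => r x xo.
have Fs A : subspace (finite_orbit A : set r) by exact: subspace_fin.
pose y i := act (l i) x - x.
pose p k i := oproj (finite_orbit (V k i)) x.
pose s k z := oproj (finite_orbit (S k) : set r) z.
have sI k z : q (s k.+1 z) = q (s k z) + q (s k.+1 z - s k z).
  by apply: q_proj_incr => //; apply: fin_sub; exact: Sdec.
have pI k i : q (p k.+1 i) = q (p k i) + q (p k.+1 i - p k i).
  by apply: q_proj_incr => //; apply: fin_sub; exact: Vdec.
have dom k z w : clos (finite_orbit (S k.+1)) z ->
    (forall m, clos (finite_orbit (S k)) m -> ip z m = 0) ->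
    ip z (s k.+1 w - s k w) = ip z w.
  move=> cz zo; rewrite ipBr proj_ip // (zo (s k w)) ?subr0 //; exact: (proj_clos _ (Fs _)).
have incr k i : i = odd k -> q (p k.+1 i - p k i) <=
    3 / 2 * q (s k.+1 x - s k x) + 3 * q (s k.+1 (y i) - s k (y i)).
  move=> ik; set D := p k.+1 i - p k i.
  have pk : p k i = oproj (finite_orbit (V k i)) (p k.+1 i).
    by rewrite [RHS]proj_sub //; apply: fin_sub; exact: Vdec.
  have cD : clos (finite_orbit (V k.+1 i)) D.
    apply: subspaceB (clos_subspace (Fs _)) (proj_clos _ (Fs _)) _.
    by apply: clos_sub (proj_clos _ (Fs _)); apply: fin_sub; exact: Vdec.
  have qD' : q D = ip D x.
    by move: (pI k i); rewrite -/D ipBl -!q_proj // -/(p _ _) -/(p _ _) => ->; ring.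
  have Do m : clos (finite_orbit (S k)) m -> ip (if odd k./2 then act (l i) D else D) m = 0.
    move=> cm; rewrite /D pk ik; apply: mo => //; exact: (proj_clos _ (Fs _)).
  case: (odd k./2) Do => Do.
    have h : q D <= q (s k.+1 (act (l i) x) - s k (act (l i) x)).
      rewrite -(q_act (l i) D); apply: q_le_ip; rewrite dom //.
        by rewrite act_ip q_act.
      have : clos (finite_orbit (conjset (l i) (V k.+1 i))) (act (l i) D).
        by apply: act_clos cD => m; exact: fin_conj.
      by apply: clos_sub; apply: fin_sub; exact: SlV.
    apply: le_trans h _; set A := s k.+1 x - s k x; set B := s k.+1 (y i) - _.
    have -> : s k.+1 (act (l i) x) - s k (act (l i) x) = A + B.
      rewrite /A /B /s !projB // addrACA -opprD.
      by rewrite ![oproj _ x + _]addrC !subrK.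
    (* q (A + B) <= 3/2 q A + 3 q B: the bound must leave the sum over both
       generators below 2 q x, so the factor of q A has to be less than 2. *)
    have := q_ge0 (2^-1 *: A - B); rewrite qB qZ ipZl qD.
    have -> : (2^-1 : R) ^+ 2 = 4^-1 by rewrite exprVn -natrX.
    lra.
  have h : q D <= q (s k.+1 x - s k x).
    apply: q_le_ip; rewrite dom //.
    by apply: clos_sub cD; apply: fin_sub; exact: SV.
  by have := q_ge0 (s k.+1 x - s k x); have := q_ge0 (s k.+1 (y i) - s k (y i)); lra.
have bound K : q (p K true) + q (p K false) <= 3 / 2 * q (s K x) +
    3 * (q (s K (y true)) + q (s K (y false))).
  elim: K => [|K IH].
    have p0 i : p 0%N i = 0.
      apply: proj_unique => //; first by case: (clos_subspace (Fs (V 0%N i))).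
      by move=> m; rewrite V0 subr0; exact: xo.
    rewrite !p0 q0; have := q_ge0 (s 0%N x); have := q_ge0 (s 0%N (y true)).
    by have := q_ge0 (s 0%N (y false)); lra.
  rewrite !sI; have := q_ge0 (s K.+1 (y true) - s K (y true)).
  have := q_ge0 (s K.+1 (y false) - s K (y false)).
  case E: (odd K).
    have -> : p K.+1 false = p K false by rewrite /p stay // E.
    by have := pI K true; have := incr K true (esym E); lra.
  have -> : p K.+1 true = p K true by rewrite /p stay // E.
  by have := pI K false; have := incr K false (esym E); lra.
suff near e : 0 < e -> exists K, forall i, q x - e <= q (p K i).
  apply/ler_addgt0Pr => e e0; have [|K hK] := near (e / 4); first by lra.
  have := bound K; have := q_proj_le x (Fs (S K)).
  have := q_proj_le (y true) (Fs (S K)); have := q_proj_le (y false) (Fs (S K)).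
  by have := hK true; have := hK false; rewrite -/(s _ _) -/(s _ _) -/(s _ _) /y; lra.
move=> e0; have [W sW hW] := act_cont x e0.
have [K1 h1] := small true W sW; have [K2 h2] := small false W sW.
exists (maxn K1 K2) => i.
have Vi : V (maxn K1 K2) i `<=` W.
  by case: i; [apply: h1; exact: leq_maxl | apply: h2; exact: leq_maxr].
suff : q (x - p (maxn K1 K2) i) <= e by rewrite q_sub_proj // -/(p _ _); lra.
apply: le_trans (q_near_le x (m := oproj (fix_by W) x) (Fs _) _) _.
  have : clos (fix_by W) (oproj (fix_by W) x) by apply: proj_clos; exact: subspace_fix.
  by apply: clos_sub => m /fix_fin; exact: fin_sub.
by apply: proj_fix_near => // u Wu; apply: ltW; exact: hW.
Qed.

End FreePair.

(** * The finite-index core *)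

(** Free-group normal form, with products associated to the left. *)
Ltac group_simpl := rewrite ?(invgM, invgK, invg1, mulgA, mulgK, mulgVK, mulVg,
  mulgV, mul1g, mulg1).

Section Core.
Variables (R : realType) (G : topologicalGroupType) (d : G -> G -> R).
Hypotheses (na : non_archimedean G) (rG : roelcke_precompact G)
  (dm : is_metric d) (dt : metric_induces_topology d) (dc : complete_metric d).
Implicit Types (A B N U V W : set G) (s : seq G) (f g h k x y z : G).

Local Notation K := (@finite_index_core G).

Lemma lcoset_repsI V W s t : open_subgroup V -> open_subgroup W -> lcoset_reps V s ->
  lcoset_reps W t -> exists u, lcoset_reps (V `&` W) u.
Proof.
move=> sV sW hs ht.
pose e (p : G * G) : G := xget (1%g : G) [set z | V (p.1^-1 * z)%g /\ W (p.2^-1 * z)%g].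
exists [seq e (f, h) | f <- s, h <- t] => g.
have [f fs Vf] := hs g; have [h ht' Wh] := ht g.
exists (e (f, h)); first by apply/allpairsP; exists (f, h).
rewrite /e; case: xgetP => [z _ [/= Vz Wz]|/(_ g)]; last by case.
have mulV x : ((x^-1 * z)^-1 * (x^-1 * g) = z^-1 * g)%g.
  by group_simpl.
split.
  by rewrite -(mulV f); apply: osubM => //; exact: osubV.
by rewrite -(mulV h); apply: osubM => //; exact: osubV.
Qed.

Lemma lcoset_reps_conj V s a : lcoset_reps V s ->
  lcoset_reps (conjset a V) [seq (f * a^-1)%g | f <- s].
Proof.
move=> hs g; have [f fs Vf] := hs (g * a)%g.
exists (f * a^-1)%g; first exact: map_f.
by rewrite /conjset /= invgM invgK !mulgA mulVg mul1g -mulgA.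
Qed.

Definition normal_fi N := [/\ open_subgroup N, exists s, lcoset_reps N s &
  forall h x, N x -> N (h^-1 * x * h)%g].

Lemma normal_fi_osub N : normal_fi N -> open_subgroup N. Proof. by case. Qed.

Lemma normal_fi_conj N h x : normal_fi N -> N x -> N (h^-1 * x * h)%g.
Proof. by case=> _ _; apply. Qed.

Lemma normal_fi_conjV N h x : normal_fi N -> N x -> N (h * x * h^-1)%g.
Proof. by move=> nN Nx; rewrite -{1}(invgK h); exact: normal_fi_conj. Qed.

Lemma normal_fiT : normal_fi setT.
Proof. by split=> //; [exact: osubT | exists [:: 1%g] => g; exists 1%g; rewrite ?inE]. Qed.

Lemma normal_fiI N M : normal_fi N -> normal_fi M -> normal_fi (N `&` M).
Proof.
move=> [sN [s hs] cN] [sM [t ht] cM]; split; first exact: osubI.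
  exact: lcoset_repsI hs ht.
by move=> h x [Nx Mx]; split; [exact: cN | exact: cM].
Qed.

(** The intersection of the conjugates of V, of which there are finitely many. *)
Lemma normal_fi_below V s : open_subgroup V -> lcoset_reps V s -> exists2 N, normal_fi N & N `<=` V.
Proof.
move=> sV hs.
pose I (l : seq G) := [set x | forall f, f \in l -> conjset f V x].
have hI l : open_subgroup (I l) /\ exists t, lcoset_reps (I l) t.
  elim: l => [|f l [IH1 [t IH2]]].
    have -> : I [::] = setT by apply/seteqP; split.
    by have [] := normal_fiT.
  have -> : I (f :: l) = conjset f V `&` I l.
    apply/seteqP; split=> x.
      move=> h; split; first by apply: h; rewrite inE eqxx.
      by move=> e el; apply: h; rewrite inE el orbT.
    by case=> Vx Ix e; rewrite inE => /orP[/eqP ->|/Ix].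
  split; first by apply: osubI => //; exact: osub_conj.
  exact: lcoset_repsI (osub_conj _ sV) IH1 (lcoset_reps_conj f hs) IH2.
have all x : I s x -> forall g, conjset g V x.
  move=> Ix g; have [f fs Vf] := hs g.
  by rewrite -[g](mulVKg f) conjM_in //; exact: Ix.
exists (I s); last by move=> x /all/(_ 1%g); rewrite conj1.
have [h1 h2] := hI s; split=> // h x Ix f fs.
by have := all x Ix (h * f)%g; rewrite /conjset /=; group_simpl.
Qed.

Lemma coreP x : K x <-> forall N, normal_fi N -> N x.
Proof.
split=> [Kx N [[oN gN] rN _]|h V [oV gV /(finite_indexP gV)[s hs]]].
  by apply: Kx; split=> //; apply/finite_indexP.
by have [N nN NV] := normal_fi_below (conj oV gV) hs; apply: NV; exact: h.
Qed.

Lemma core1 : K 1%g.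
Proof. by have /group_closedP[] := @finite_index_core_closed G. Qed.
Lemma coreM x y : K x -> K y -> K (x * y)%g.
Proof.
move=> /coreP hx /coreP hy; apply/coreP => N nN.
by apply: osubM; [exact: normal_fi_osub | exact: hx | exact: hy].
Qed.
Lemma coreV x : K x -> K (x^-1)%g.
Proof.
move=> /coreP hx; apply/coreP => N nN.
by apply: osubV; [exact: normal_fi_osub | exact: hx].
Qed.
Lemma core_conj h x : K x -> K (h^-1 * x * h)%g.
Proof. by move=> /coreP hx; apply/coreP => N nN; apply: normal_fi_conj => //; exact: hx. Qed.
Lemma core_conjV h x : K x -> K (h * x * h^-1)%g.
Proof. by move=> Kx; rewrite -{1}(invgK h); exact: core_conj. Qed.

(** N A is a union of double cosets of A, of which there are finitely many: the
    decreasing family of the N A has a least element. *)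
Lemma normal_fi_stable A : open_subgroup A -> exists2 N0, normal_fi N0 & forall z n, N0 n -> A (n * z)%g ->
  forall N, normal_fi N -> exists2 n, N n & A (n * z)%g.
Proof.
move=> sA; have [s hs] := double_cosets rG sA.
pose P z N := exists2 n, N n & A (n * z)%g.
have [N0 nN0 hN0] : exists2 N0, normal_fi N0 &
    forall e, e \in s -> P e N0 -> forall N, normal_fi N -> P e N.
  elim: {hs} s => [|e s [M nM hM]]; first by exists setT; [exact: normal_fiT|].
  have [h|] := pselect (forall N, normal_fi N -> P e N).
    exists M => // f; rewrite inE => /orP[/eqP ->|fs] //; exact: hM.
  move=> /existsNP[M' /not_implyP[nM' nP]]; exists (M `&` M'); first exact: normal_fiI.
  move=> f; rewrite inE => /orP[/eqP ->|fs] [n [Mn M'n] An].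
    by case: nP; exists n.
  by apply: hM => //; exists n.
exists N0 => // z n N0n Anz N nN.
have [u [e [v [Au es Av zE]]]] := hs z.
have [|m Nm Ame] := hN0 e es _ N nN.
  exists (u^-1 * n * u)%g; first exact: normal_fi_conj.
  have := osubM sA (osubV sA Au) (osubF sA Anz Av).
  by rewrite zE; group_simpl.
exists (u * m * u^-1)%g; first exact: normal_fi_conjV.
have := osubM sA Au (osubM sA Ame Av).
by rewrite zE; group_simpl.
Qed.

(** K W contains a subgroup of finite index.  An element of the smallest N W lies in
    N W for all N; the zigzag finds one element of its coset of W that lies in all N
    at once, as the quotient of the limits of x and y with x in y B N for all N. *)
Lemma core_product W : open_subgroup W -> exists2 N, normal_fi N &
  forall g, N g -> exists2 k, K k & W (k^-1 * g)%g.
Proof.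
move=> sW; have [N0 nN0 hN0] := normal_fi_stable sW; exists N0 => // g N0g.
pose Phi b x y B := [/\ B `<=` W, W (if b then g^-1 * x else x)%g,
  W (if b then y else g^-1 * y)%g &
  forall N, normal_fi N -> exists2 n, N n & B (n * (y^-1 * x))%g].
have [|||p [h hph]] := @zigzag R G d na dm dt dc Phi g 1%g W.
- move=> b x y A B sA sB AB [BW Wx Wy hN].
  have [NA nNA hNA] := normal_fi_stable sA; have [n NAn Bn] := hN NA nNA.
  exists (y * (n * (y^-1 * x)))%g; first by rewrite mulKg.
  split.
  - exact: subset_trans AB BW.
  - have := osubM sW Wy (BW _ Bn); case: (b) => //=; rewrite ?mulgA //.
  - by case: (b) Wx.
  - move=> N nN; pose m := ((y^-1 * x)^-1 * n * (y^-1 * x))%g.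
    have NAm : NA m by exact: normal_fi_conj.
    have -> : (x^-1 * (y * (n * (y^-1 * x))) = m)%g by rewrite /m; group_simpl.
    apply: (hNA _ (m^-1)%g) => //; first by apply: osubV => //; exact: normal_fi_osub.
    by rewrite mulVg; exact: osub1.
- exact: sW.
- split=> //; [by rewrite mulVg; exact: osub1 | exact: osub1 |].
  move=> N nN; group_simpl; apply: (hN0 _ (g^-1)%g) => //.
    by apply: osubV => //; exact: normal_fi_osub.
  by rewrite mulVg; exact: osub1.
exists (p / h)%g.
  apply/coreP => N nN; have sN := normal_fi_osub nN.
  have [x [y [B [[_ _ _ hN] px hy BN]]]] := hph N sN.
  have [n Nn /BN Nyx] := hN N nN.
  have Ny : N (y^-1 * x)%g by have := osubM sN (osubV sN Nn) Nyx; rewrite mulKg.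
  have := normal_fi_conjV h nN (osubF sN (osubM sN hy Ny) px).
  by group_simpl.
have [x [y [B [[_ Wx Wy _] px hy _]]]] := hph W sW.
have Wh : W h by have := osubF sW Wy hy; group_simpl.
have Wp : W (g^-1 * p)%g.
  by have := osubF sW Wx px; group_simpl.
by have := osubF sW Wh Wp; group_simpl.
Qed.

Lemma core_reps W : open_subgroup W -> exists s, forall g, exists f k w,
  [/\ f \in s, K k, W w & g = (f * k * w)%g].
Proof.
move=> sW; have [N [sN [s hs] _] hN] := core_product sW; exists s => g.
have [f fs /hN[k Kk Wk]] := hs g.
by exists f, k, (k^-1 * (f^-1 * g))%g; split=> //; rewrite -mulgA mulVKg mulVKg.
Qed.

(** Double cosets of K `&` V in K correspond to K-orbits on pairs of cosets of V,
    that is to K-orbits on the cosets of V `&` e V e^-1, for finitely many e; by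
    the previous lemma each e contributes finitely many. *)
Lemma core_double_cosets V : open_subgroup V -> exists2 s : seq G, (forall e, e \in s -> K e) &
  forall k, K k -> exists u e v,
    [/\ K u, V u & e \in s] /\ [/\ K v, V v & k = (u * e * v)%g].
Proof.
move=> sV; have [s hs] := double_cosets rG sV.
have [t ht] := boolp.choice (fun e => core_reps (osubI sV (osub_conj e sV))).
pose P k (c : G * G) := [/\ c.1 \in s, c.2 \in t c.1 & exists k',
  [/\ K k', V (k' * c.2)%g & V ((k' * c.2 * c.1)^-1 * k)%g]].
have exP k : exists c, P k c.
  have [u [e [v [Vu es Vv kE]]]] := hs k.
  have [f [k' [w [ft Kk' [Vw Cw] uE]]]] := ht e u.
  exists (e, f); split=> //; exists (f * k' * f^-1)%g.
  rewrite mulgVK; have fk : (f * k' = u / w)%g by rewrite uE mulgK.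
  split; [exact: core_conjV | by rewrite fk; exact: osubF |].
  rewrite fk kE; group_simpl.
  by have := osubM sV Cw Vv.
have [c cP] := boolp.choice exP.
have [|r rK rP] := @finite_reps G _ c K.
  apply: sub_finite_set (finite_seq [seq (e, f) | e <- s, f <- t e]).
  move=> _ [k _ <-]; have [h1 h2 _] := cP k.
  by apply/allpairsPdep; exists (c k).1, (c k).2; rewrite -surjective_pairing.
exists r => // k Kk; have [k0 k0r ck] := rP k Kk.
have [_ _ [x [Kx Vx Vxk]]] := cP k; have [_ _ [y [Ky Vy Vyk]]] := cP k0.
rewrite ck in Vy Vyk; have Kk0 := rK _ k0r.
move: (c k).1 (c k).2 Vx Vxk Vy Vyk => e f Vx Vxk Vy Vyk.
have uE : ((x * f) / (y * f) = x / y)%g by group_simpl.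
have Vu : V (x / y)%g by rewrite -uE; exact: osubF.
have Vv : V ((x / y * k0)^-1 * k)%g.
  have := osubM sV (osubV sV Vyk) Vxk.
  by group_simpl.
exists (x / y)%g, k0, ((x / y * k0)^-1 * k)%g; split; split=> //.
- by apply: coreM => //; exact: coreV.
- by apply: coreM => //; apply: coreV; apply: coreM => //; apply: coreM => //; exact: coreV.
- by rewrite mulVKg.
Qed.

(** Open finite-index subgroups L of K with K `&` U `<=` L have a least element
    L0, which U normalises; L0 U is then open of finite index in G, so that it
    contains K. *)
Lemma core_no_finite_index U (L : set G) s : open_subgroup U -> L `<=` K -> L 1%g ->
  (forall x y, L x -> L y -> L (x / y)%g) ->
  (forall x, K x -> U x -> L x) ->
  (forall k, K k -> exists2 f, f \in s & L (f^-1 * k)%g) -> K `<=` L.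
Proof.
move=> sU LK L1 LF UL Ls.
pose sub (L : set G) := [/\ L `<=` K, L 1%g, (forall x y, L x -> L y -> L (x / y)%g),
  (forall x, K x -> U x -> L x) &
  exists s, forall k, K k -> exists2 f, f \in s & L (f^-1 * k)%g].
have subV M x : sub M -> M x -> M (x^-1)%g.
  by case=> _ M1 MF _ _ Mx; rewrite -div1g; exact: MF.
have subM M x y : sub M -> M x -> M y -> M (x * y)%g.
  by move=> sM Mx My; rewrite -(invgK y); case: (sM) => _ _ + _ _; apply=> //; exact: subV.
have subI M M' : sub M -> sub M' -> sub (M `&` M').
  move=> sM sM'; case: (sM) (sM') => MK M1 MF UM [t ht] [_ M'1 M'F UM' [t' ht']].
  split; [by move=> x [/MK] | by [] | | |].
  - by move=> x y [? ?] [? ?]; split; [exact: MF | exact: M'F].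
  - by move=> x Kx Ux; split; [exact: UM | exact: UM'].
  pose e (p : G * G) : G := xget (1%g : G) [set z | M (p.1^-1 * z)%g /\ M' (p.2^-1 * z)%g].
  exists [seq e (f, h) | f <- t, h <- t'] => g Kg.
  have [f ft Mf] := ht g Kg; have [h ht'' Mh] := ht' g Kg.
  exists (e (f, h)); first by apply/allpairsP; exists (f, h).
  rewrite /e; case: xgetP => [z _ [/= Mz M'z]|/(_ g)]; last by case.
  have mulV x : ((x^-1 * z)^-1 * (x^-1 * g) = z^-1 * g)%g.
    by group_simpl.
  split; [rewrite -(mulV f) | rewrite -(mulV h)].
    by apply: (subM) => //; exact: subV.
  by apply: (subM) => //; exact: subV.
have sL : sub L by split=> //; exists s.
have [t tK ht] := core_double_cosets sU.
have [L0 sL0 hL0] : exists2 L0, sub L0 &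
    forall e, e \in t -> L0 e -> forall M, sub M -> M e.
  elim: {tK ht} t => [|e t [M sM hM]]; first by exists L.
  have [h|] := pselect (forall M, sub M -> M e).
    by exists M => // f; rewrite inE => /orP[/eqP ->|ft] //; exact: hM.
  move=> /existsNP[M' /not_implyP[sM' nM'e]]; exists (M `&` M'); first exact: subI.
  by move=> f; rewrite inE => /orP[/eqP ->|ft] [Mf M'f] //; exact: hM.
have min M : sub M -> L0 `<=` M.
  move=> sM x L0x; case: (sL0) => L0K _ _ UL0 _.
  have [u [e [v [[Ku Uu et] [Kv Uv xE]]]]] := ht x (L0K x L0x).
  have L0e : L0 e.
    have -> : e = (u^-1 * x * v^-1)%g by rewrite xE; group_simpl.
    apply: (subM) => //; last by apply: (subV) => //; exact: UL0.
    by apply: (subM) => //; apply: (subV) => //; exact: UL0.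
  have UM z : K z -> U z -> M z by case: sM => _ _ _ + _; apply.
  rewrite xE; apply: (subM) => //; last exact: UM.
  by apply: (subM) => //; [exact: UM | exact: hL0].
have norm u x : U u -> L0 x -> L0 (u * x * u^-1)%g.
  move=> Uu L0x; apply: (min [set z | L0 (u * z * u^-1)%g]) => //.
  case: (sL0) => L0K L01 L0F UL0 [r hr]; split => /=.
  - by move=> z /L0K/(core_conj u); group_simpl.
  - by group_simpl.
  - by move=> y z Ly Lz; have := L0F _ _ Ly Lz; group_simpl.
  - move=> z Kz Uz; apply: UL0; first exact: core_conjV.
    by apply: osubF => //; exact: osubM.
  - exists [seq (u^-1 * f * u)%g | f <- r] => k Kk.
    have [f fr Lf] := hr _ (core_conjV u Kk); exists (u^-1 * f * u)%g; first exact: map_f.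
    by move: Lf; group_simpl.
case: (sL0) => L0K L01 L0F UL0 [r hr].
pose M := [set g | exists2 l, L0 l & U (l^-1 * g)%g].
have gM : group_closed [in M].
  apply/group_closedP; split; first by exists 1%g => //; group_simpl; exact: osub1.
  move=> x y [l Ll Ux] [l' Ll' Uy]; pose w := ((l^-1 * x) / (l'^-1 * y))%g.
  have Uw : U w by exact: osubF.
  exists (l * (w * l'^-1 * w^-1))%g.
    by apply: (subM) => //; apply: norm => //; exact: subV.
  by move: Uw; rewrite /w; group_simpl.
have sM : open_subgroup M.
  apply: (osub_super gM sU) => u Uu; exists 1%g => //.
  by rewrite invg1 mul1g.
have [a ha] := core_reps sU.
have Ms : lcoset_reps M [seq (f * h)%g | f <- a, h <- r].
  move=> g; have [f [k [w [fa Kk Uw ->]]]] := ha g; have [h hr' Lh] := hr k Kk.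
  exists (f * h)%g; first by apply/allpairsP; exists (f, h).
  exists (h^-1 * k)%g => //.
  by group_simpl.
have KM : K `<=` M.
  move=> x Kx; apply: Kx; split=> //; first by case: sM.
  by apply/finite_indexP => //; exists [seq (f * h)%g | f <- a, h <- r].
move=> x Kx; apply: (min L sL); have [l Ll Ul] := KM x Kx.
have : L0 (l^-1 * x)%g by apply: UL0 => //; apply: coreM => //; apply: coreV; exact: L0K.
by move=> /(subM _ _ _ sL0 Ll); rewrite mulVKg.
Qed.

Lemma core_closed x : (forall U, open_subgroup U -> exists2 k, K k & U (x^-1 * k)%g) -> K x.
Proof.
move=> h; apply/coreP => N nN; have sN := normal_fi_osub nN.
have [k /coreP/(_ N nN) Nk Nxk] := h N sN.
by have := osubF sN Nk Nxk; group_simpl.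
Qed.

Lemma divg_continuous : continuous (fun z : G * G => z.1 / z.2)%g.
Proof.
move=> z; rewrite (_ : (fun z : G * G => _) = (fun y : G * G => (y.1 * y.2)%g) \o
  (fun z : G * G => (z.1, (z.2^-1)%g : G))) //.
apply: continuous_comp; last exact: mulg_continuous.
apply: cvg_pair => /=; first exact: cvg_fst.
by apply: continuous_comp; [exact: cvg_snd | exact: invg_continuous].
Qed.

(** The group G / K is compact; since G is complete, the whole of it is the image
    of a compact subset of G. *)
Lemma core_compact_lift : exists2 C : set G, compact C &
  forall g, exists2 c, C c & K (c^-1 * g)%g.
Proof.
pose Phi g (b : bool) x y B := exists2 k, K k &
  B (y^-1 * (if b then g^-1 else g) * x * k)%g.
have [|C1 [C2 [c1 c2 hC]]] := @uniform_zigzag R G d na dm dt dc G Phi _ 1%g 1%g setT (osubT G).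
  move=> b x y A B sA sB AB; have [s hs] := core_reps sA.
  have [c cP] := boolp.choice hs.
  have [|Y YB YP] := @finite_reps G _ c [set z | B (y^-1 * z)%g].
    apply: sub_finite_set (finite_seq s) => _ [z _ <-].
    by have [k [w []]] := cP z.
  exists Y => // g [k Kk Bk]; set e := (if b then _ else _) in Bk.
  have [|z' z'Y cz] := YP (e * x * k)%g; first by rewrite /= !mulgA.
  exists z' => //.
  have [k1 [w1 [_ Kk1 Aw1 z'E]]] := cP z'.
  have [k2 [w2 [_ Kk2 Aw2 zE]]] := cP (e * x * k)%g.
  rewrite cz in z'E.
  pose a := (w2^-1 * w1)%g; have Aa : A a by apply: osubM => //; exact: osubV.
  pose k3 := (w2^-1 * (k2^-1 * k1) * w2)%g.
  have Kk3 : K k3 by apply: core_conj; apply: coreM => //; exact: coreV.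
  have z'E2 : z' = (e * x * k * k3 * a)%g.
    by rewrite zE z'E /k3 /a; group_simpl.
  exists ((a^-1 * (k * k3) * a)^-1)%g.
    by apply: coreV; apply: core_conj; exact: coreM.
  have -> : (if ~~ b then g^-1 else g)%g = (e^-1)%g by rewrite /e; case: (b); rewrite ?invgK.
  by rewrite z'E2; group_simpl.
exists ((fun z : G * G => z.1 * z.2^-1)%g @` (C1 `*` C2)).
  apply: continuous_compact; last exact: compact_setX.
  exact: (continuous_subspaceT divg_continuous).
move=> g; have [|p [h [C1p C2h hph]]] := hC g.
  by exists 1%g => //; exact: core1.
exists (p / h)%g; first by exists (p, h).
apply/coreP => N nN; have sN := normal_fi_osub nN.
have [x [y [B [[k /coreP/(_ N nN) Nk Bk] px hy BN]]]] := hph N sN.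
have Ng : N (y^-1 * g^-1 * x)%g by have := osubF sN (BN _ Bk) Nk; rewrite mulgK.
have := normal_fi_conjV h nN (osubV sN (osubF sN (osubM sN hy Ng) px)).
by group_simpl.
Qed.

End Core.

(** * Unitary representations as orthogonal representations *)

Section Realify.
Variables (R : realType) (H : hilbertSpace R).
Implicit Types (x y z : H) (r : R).

Local Notation C := R[i].

Lemma hnormE x : `|x| = (hnorm x)%:C%C.
Proof.
by rewrite /hnorm; have := normr_ge0 x; case: `|x| => a b; rewrite lecE /= => /andP[/eqP -> _].
Qed.

Lemma hnorm_ge0 x : 0 <= hnorm x.
Proof. by have := normr_ge0 x; rewrite hnormE lecR. Qed.

Definition rip x y : R := complex.Re (hdot H x y).

Lemma ripC x y : rip x y = rip y x.
Proof.
rewrite /rip (hermC (hdot H) x y) expr0 mul1r; apply: complexI.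
by rewrite !complexRe Re_conj.
Qed.

Lemma ripDl x y z : rip (x + y) z = rip x z + rip y z.
Proof.
have ReD (a b : C) : complex.Re (a + b) = complex.Re a + complex.Re b.
  by case: a b => ? ? [].
by rewrite /rip linearDl ReD.
Qed.

Lemma ripZl r x y : rip (r%:C%C *: x) y = r * rip x y.
Proof.
have ReZ (a : R) (b : C) : complex.Re (a%:C%C * b) = a * complex.Re b.
  by case: b => b c /=; rewrite mul0r subr0.
by rewrite /rip linearZl_LR ReZ.
Qed.

Lemma rip_hnorm x : rip x x = hnorm x ^+ 2.
Proof. by rewrite /rip hdotE hnormE expr2 /= mulr0 subr0 expr2. Qed.

Lemma rip_eq0 x : rip x x = 0 -> x = 0.
Proof.
rewrite rip_hnorm => /eqP; rewrite sqrf_eq0 => /eqP h.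
by apply/eqP; rewrite -normr_eq0 hnormE h.
Qed.

(** An alias of H, to carry a real module structure next to the complex one. *)
Definition realified : Type := H.
HB.instance Definition _ := GRing.Zmodule.on realified.

Let scale r (x : realified) : realified := r%:C%C *: (x : H).
Let scaleA a b x : scale a (scale b x) = scale (a * b) x.
Proof. by rewrite /scale scalerA rmorphM. Qed.
Let scale1 : left_id 1 scale.
Proof. by move=> x; rewrite /scale rmorph1 scale1r. Qed.
Let scaleDr : right_distributive scale +%R.
Proof. by move=> a x y; rewrite /scale scalerDr. Qed.
Let scaleDl x : {morph scale^~ x : a b / a + b}.
Proof. by move=> a b; rewrite /scale rmorphD scalerDl. Qed.
HB.instance Definition _ := GRing.Zmodule_isLmodule.Build R realified
  scaleA scale1 scaleDr scaleDl.

Lemma norm_lt_hnorm x e : (`|x| < e%:C%C) = (hnorm x < e).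
Proof. by rewrite hnormE ltcR. Qed.

Lemma hnorm_sqr_lt x e : 0 < e -> rip x x < e ^+ 2 -> `|x| < e%:C%C.
Proof.
move=> e0; rewrite rip_hnorm norm_lt_hnorm => h; have := hnorm_ge0 x.
by rewrite ltNge; apply: contraTN => he; rewrite -ltNge; nra.
Qed.

Lemma rip_complete (u : nat -> realified) :
  (forall e, 0 < e -> exists N, forall m n, (N <= m)%N -> (N <= n)%N ->
     rip (u m - u n) (u m - u n) < e) ->
  exists l : realified, forall e, 0 < e -> exists N, forall n, (N <= n)%N ->
     rip (u n - l) (u n - l) < e.
Proof.
move=> cu; pose v : nat -> H := u.
have cv : cvg (v @ \oo).
  apply/cauchy_cvgP/cauchy_exP => e e0.
  have eE : e = (complex.Re e)%:C%C.
    by move: e0; case: (e) => a b; rewrite ltcE /= => /andP[/eqP -> _].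
  have r0 : 0 < complex.Re e by move: e0; rewrite eE ltcR.
  have [N hN] := cu (complex.Re e ^+ 2) (exprn_gt0 2 r0).
  exists (v N); exists N => // n /= Nn; rewrite -ball_normE /= eE.
  by apply: hnorm_sqr_lt => //; exact: hN.
exists (lim (v @ \oo)) => e e0.
pose c := Num.min 1 e; have c0 : 0 < c by rewrite lt_min ltr01.
have /cvgrPdist_lt/(_ c%:C%C) : v @ \oo --> lim (v @ \oo) by [].
rewrite ltcR => /(_ c0)[N _ hN]; exists N => n /hN /=.
rewrite distrC norm_lt_hnorm rip_hnorm => hc.
have h0 := hnorm_ge0 (v n - lim (v @ \oo)).
have : c <= 1 by rewrite ge_min lexx.
have : c <= e by rewrite ge_min lexx orbT.
rewrite -/v; set a := hnorm _ in hc h0 *; rewrite expr2 => h1 h2.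
by nra.
Qed.

Lemma rip_ge0 x : 0 <= rip x x.
Proof. by rewrite rip_hnorm sqr_ge0. Qed.

Definition realify : real_hilbert R := @RealHilbert R realified rip ripC ripDl ripZl rip_ge0
  rip_eq0 rip_complete.

Variables (G : topologicalGroupType) (pi : G -> H -> H).
Hypotheses (na : non_archimedean G) (upi : unitary_representation pi).

Let act (g : G) (x : realify) : realify := pi g x.
Let act1 (x : realify) : act 1%g x = x.
Proof.
have [u m _] := upi; have [_ /bij_inj inj _] := u 1%g; apply: inj.
by have := m 1%g 1%g; rewrite mulg1 => /(congr1 (fun f => f x)).
Qed.
Let actM g h (x : realify) : act (g * h)%g x = act g (act h x).
Proof. by have [_ m _] := upi; rewrite /act m. Qed.
Let actD g (x y : realify) : act g (x + y) = act g x + act g y.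
Proof.
have [u _ _] := upi; have [l _ _] := u g.
by have := l 1 x y; rewrite !scale1r.
Qed.
Let actZ g r (x : realify) : act g (r *: x) = r *: act g x.
Proof.
have [u _ _] := upi; have [l _ _] := u g.
have p0 : pi g 0 = 0 by have := l (-1) 0 0; rewrite scaler0 addr0 scaleN1r addNr.
by have := l (r%:C)%C x 0; rewrite p0 !addr0.
Qed.
Let act_ip g (x y : realify) : ip (act g x) (act g y) = ip x y.
Proof. by have [u _ _] := upi; have [_ _ h] := u g; rewrite /ip /= /rip h. Qed.
Let act_cont (x : realify) e : 0 < e -> exists2 U, open_subgroup U &
  forall u, U u -> q (act u x - x) < e.
Proof.
move=> e0; have [_ _ c] := upi.
pose r := Num.min 1 e; have r0 : 0 < r by rewrite lt_min ltr01.
have : nbhs (1%g : G) [set g | `|pi g x - x| < r%:C%C].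
  have /cvgrPdist_lt/(_ r%:C%C) := c x 1%g; rewrite ltcR => /(_ r0).
  have x1 : pi 1%g x = x := act1 x.
  by apply: filterS => g /=; rewrite x1 distrC.
move=> /(nonarch_nbhs na)[U sU hU]; exists U => // u /hU /=.
rewrite norm_lt_hnorm => hc.
suff : rip (pi u x - x) (pi u x - x) < e by [].
rewrite rip_hnorm; have h0 := hnorm_ge0 (pi u x - x); move: hc h0; set a := hnorm _ => hc h0.
have h1 : r <= 1 by rewrite ge_min lexx.
have h2 : r <= e by rewrite ge_min lexx orbT.
by rewrite expr2; nra.
Qed.

Definition realify_rep : ortho_rep R G := OrthoRep act1 actM actD actZ act_ip act_cont.

Lemma almost_invariant_q (Q : set G) e x : almost_invariant pi Q e x ->
  [/\ x != 0, 0 < q (x : realify) &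
    forall g, Q g -> q (act g x - x) <= e ^+ 2 * q (x : realify)].
Proof.
move=> [x0 hx]; split=> //.
  by apply: q_gt0.
move=> g Qg.
have h : hnorm (pi g x - x) < e * hnorm x.
  rewrite -lte_fin; apply: le_lt_trans hx; apply: ereal_sup_ubound.
  by exists g.
suff : rip (pi g x - x) (pi g x - x) <= e ^+ 2 * rip x x by [].
rewrite !rip_hnorm; have h0 := hnorm_ge0 (pi g x - x).
by rewrite -exprMn; apply: lerXn2r; rewrite ?nnegrE; lra.
Qed.

End Realify.

(** * The core as a topological group *)

Section NoFiniteIndex.
Variables (R : realType) (G : topologicalGroupType).
Hypothesis nofi : forall L : set G,
  open_subgroup L -> (exists s, lcoset_reps L s) -> forall g, L g.

(** The stabiliser is open and of finite index, hence everything. *)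
Lemma fin_fixed (r : ortho_rep R G) (x : r) : finite_orbit setT x -> fix_by setT x.
Proof.
move=> fx g _; have [U [sU _] fU] := fin_fix_open (osubT G) fx.
apply: (nofi (L := [set g | act g x = x])).
  apply: osub_super sU fU; apply/group_closedP; split; first exact: act1.
  by move=> h k /= hx kx; rewrite actM -[X in act (k^-1)%g X]kx actK.
have [s _ hs] := finite_reps fx; exists s => h.
by have [f fs fE] := hs h I; exists f => //=; rewrite actM -fE actK.
Qed.
End NoFiniteIndex.

Section CoreGroup.
Variables (R : realType) (G : topologicalGroupType) (d : G -> G -> R).
Hypotheses (na : non_archimedean G) (rG : roelcke_precompact G)
  (dm : is_metric d) (dt : metric_induces_topology d) (dc : complete_metric d).

Local Notation K := (@finite_index_core G).
Local Notation KG := (finite_index_core_group G).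

Definition core_val (x : KG) : G := val x.

Lemma core_valF x y : core_val (x / y)%g = (core_val x / core_val y)%g.
Proof. by []. Qed.
Lemma core_valM x y : core_val (x * y)%g = (core_val x * core_val y)%g.
Proof. by []. Qed.
Lemma core_val_inj : injective core_val. Proof. exact: val_inj. Qed.
Lemma core_valP x : K (core_val x).
Proof. by have := valP x; rewrite in_setE. Qed.
Lemma core_val_onto k : K k -> exists x, core_val x = k.
Proof. by rewrite -in_setE => Kk; exists (Sub k Kk); exact: SubK. Qed.

Lemma core_val_continuous : continuous core_val.
Proof. exact: subgroup_val_continuous. Qed.

Lemma core_open (A : set KG) : open A -> exists2 B, open B & core_val @^-1` B = A.
Proof. by case=> B oB <-; exists B. Qed.

Lemma core_osub (U : set G) : open_subgroup U -> open_subgroup (core_val @^-1` U).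
Proof.
move=> sU; split; first by move/continuousP: core_val_continuous; apply; case: sU.
apply/group_closedP; split; first exact: (osub1 sU).
by move=> x y /=; rewrite core_valF; exact: osubF.
Qed.

Lemma core_nbhs (U : set KG) : open_nbhs 1%g U ->
  exists2 V, open_subgroup V & core_val @^-1` V `<=` U.
Proof.
move=> [oU U1]; have [B oB BU] := core_open oU; rewrite -BU in U1 *.
have [V sV VB] : exists2 V, open_subgroup V & V `<=` B.
  by apply: nonarch_nbhs => //; apply: open_nbhs_nbhs.
by exists V => // x Vx; exact: VB.
Qed.

Lemma core_non_archimedean : non_archimedean KG.
Proof.
move=> U /core_nbhs[V sV VU]; exists (core_val @^-1` V).
by have [] := core_osub sV.
Qed.

Lemma core_roelcke : roelcke_precompact KG.
Proof.
move=> U /core_nbhs[V sV VU].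
have [s sK hs] := core_double_cosets na rG dm dt dc sV.
exists [set x | core_val x \in s].
  apply: finite_preimage (finite_seq s); first by move=> x y _ _; exact: core_val_inj.
move=> g; have [u [e [v [[Ku Vu es] [Kv Vv gE]]]]] := hs _ (core_valP g).
have [u' u'E] := core_val_onto Ku; have [v' v'E] := core_val_onto Kv.
have [e' e'E] := core_val_onto (sK e es).
exists u', e', v'; split.
- by apply: VU; rewrite /= u'E.
- by rewrite /= e'E.
- by apply: VU; rewrite /= v'E.
- by apply: core_val_inj; rewrite !core_valM u'E e'E v'E.
Qed.

Definition core_dist (x y : KG) := d (core_val x) (core_val y).

Lemma core_is_metric : is_metric core_dist.
Proof.
have [d0 dC d_tri] := dm; split=> [x y|x y|x y z].
- by rewrite /core_dist d0; split=> [/core_val_inj //|-> //].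
- exact: dC.
- exact: d_tri.
Qed.

Lemma core_metric_topology : metric_induces_topology core_dist.
Proof.
move=> x A; split=> [|[e e0 hA]].
  rewrite nbhsE => -[B [oB Bx] BA]; have [W oW WB] := core_open oB.
  rewrite -WB in Bx BA.
  have /dt[e e0 he] : nbhs (core_val x) W by exact: open_nbhs_nbhs.
  by exists e => // y /he Wy; exact: BA.
have nx : nbhs x [set y | core_dist x y < e].
  apply: (@core_val_continuous x [set y | d (core_val x) y < e]).
  by apply/dt; exists e.
exact: filterS hA nx.
Qed.

Lemma core_complete : complete_metric core_dist.
Proof.
move=> u cu; have [l hl] := cauchy_lim dm dt dc (u := core_val \o u) (fun e e0 =>
  let: ex_intro N hN := cu e e0 in ex_intro _ N (fun n Nn => hN N n (leqnn N) Nn)).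
have Kl : K l.
  apply: core_closed => U sU.
  have : nbhs l [set z | U (l^-1 * z)%g].
    apply: open_nbhs_nbhs; split; first exact: open_lcoset sU.1.
    by rewrite /= mulVg; exact: osub1.
  move=> /dt[e e0 he]; have [N hN] := hl e e0.
  by exists (core_val (u N)); [exact: core_valP | apply: he; exact: hN].
have [y yl] := core_val_onto Kl; exists y => A /core_metric_topology[e e0 hA].
have [N hN] := hl e e0; exists N => // n /= Nn; apply: hA.
by rewrite /= /core_dist yl; exact: hN.
Qed.

Lemma core_no_finite_index_subgroup (L : set KG) : open_subgroup L -> (exists s, lcoset_reps L s) -> forall g, L g.
Proof.
move=> sL [s hs] g.
have [|U sU UL] := @core_nbhs L; first by split; [case: sL | exact: osub1].
have [] := @core_no_finite_index R G d na rG dm dt dc U (core_val @` L)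
  [seq core_val f | f <- s] sU _ _ _ _ _ _ (core_valP g).
- by move=> _ [x _ <-]; exact: core_valP.
- by exists 1%g => //; exact: osub1.
- move=> _ _ [x Lx <-] [y Ly <-]; exists (x / y)%g => //; exact: osubF.
- move=> x /core_val_onto[y <-] Uy; exists y => //; exact: UL.
- move=> k /core_val_onto[y <-]; have [f fs Lf] := hs y.
  exists (core_val f); first exact: map_f.
  by exists (f^-1 * y)%g.
- by move=> y Ly /core_val_inj <-.
Qed.

Section Restriction.
Variable r : ortho_rep R G.
Let cact (k : KG) (x : r) : r := act (core_val k) x.
Let cact1 x : cact 1%g x = x. Proof. exact: act1. Qed.
Let cactM g h x : cact (g * h)%g x = cact g (cact h x). Proof. exact: actM. Qed.
Let cactD g x y : cact g (x + y) = cact g x + cact g y. Proof. exact: actD. Qed.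
Let cactZ g a x : cact g (a *: x) = a *: cact g x. Proof. exact: actZ. Qed.
Let cact_ip g x y : ip (cact g x) (cact g y) = ip x y. Proof. exact: act_ip. Qed.
Let cact_cont x e : 0 < e -> exists2 U, open_subgroup U &
  forall u, U u -> q (cact u x - x) < e.
Proof.
move=> e0; have [U sU hU] := act_cont x e0.
by exists (core_val @^-1` U); [exact: core_osub | move=> u /hU].
Qed.
Definition core_rep : ortho_rep R KG := OrthoRep cact1 cactM cactD cactZ cact_ip cact_cont.
End Restriction.

Lemma core_gap : exists l : bool -> KG, forall (r : ortho_rep R KG) (x : r),
  (forall m, fix_by setT m -> ip x m = 0) ->
  q x <= 6 * (q (act (l true) x - x) + q (act (l false) x - x)).
Proof.
have [l hl] := @spectral_gap R KG core_dist core_non_archimedean core_roelcke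
  core_is_metric core_metric_topology core_complete.
exists l => r x xo; apply: hl => m /(fin_fixed core_no_finite_index_subgroup); exact: xo.
Qed.

End CoreGroup.

(** The closed convex hull of a bounded orbit contains a fixed vector, which is not
    0 as soon as the orbit stays closer to x than 0 is. *)
Lemma fix_nonzero (R : realType) (G : topologicalGroupType) (r : ortho_rep R G)
    (x : r) c :
  (forall g, q (act g x - x) <= c) -> c < q x ->
  exists2 y : r, y != 0 & forall g, act g y = y.
Proof.
move=> hc cx; exists (oproj (fix_by setT) x).
  apply: contraTneq cx => y0; rewrite -leNgt.
  by have := proj_fix_near (osubT G) (x := x) (c := c); rewrite y0 subr0; apply => u _.
move=> g; apply: qclosed_fix (I : setT g); apply: proj_clos; exact: subspace_fix.
Qed.

Lemma fix_core_act (R : realType) (G : topologicalGroupType) (r : ortho_rep R G) (x : r) g :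
  fix_by (@finite_index_core G) x -> fix_by (@finite_index_core G) (act g x).
Proof.
move=> fx k Kk; have := fx _ (core_conj g Kk).
by rewrite !actM => /(congr1 (act g)); rewrite actVK.
Qed.

Theorem theorem1p1 (R : realType) (G : topologicalGroupType) :
  non_archimedean G -> roelcke_precompact G -> polish R G ->
  [/\ property_T R G,
      property_T R (finite_index_core_group G) &
      finite_kazhdan_set R (finite_index_core_group G)].
Proof.
move=> na rG [_ [d [dm dt dc]]].
have [l hl] := core_gap na rG dm dt dc.
pose QK : set (finite_index_core_group G) := [set l true; l false].
have fQ : finite_set QK by rewrite /QK finite_setU; split; exact: finite_set1.
have e0 : 0 < 10%:R^-1 :> R by rewrite invr_gt0.
(* With e = 1/10 the gap gives q z <= 12 e ^ 2 q x < q x for the component z of x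
   orthogonal to the invariants, and the rest of x is then moved by less than its
   own norm: e ^ 2 < 1 - 12 e ^ 2. *)
have e2 : (10%:R^-1 : R) ^+ 2 = 100%:R^-1 by rewrite exprVn -natrX.
have naK := core_non_archimedean na.
have kK : kazhdan_pair QK (10%:R^-1 : R).
  split=> // H pi upi [x aix].
  have [x0 qx hx] := almost_invariant_q aix.
  apply: contrapT => nofix.
  pose r := realify_rep naK upi; pose y : r := x.
  have yo (m : r) : fix_by setT m -> ip y m = 0.
    move=> fm; have -> : m = 0; last exact: ip0r.
    apply: contrapT => /eqP m0; apply: nofix; exists m => // g; exact: fm.
  have h1 : q (act (l true) y - y) <= (10%:R^-1 : R) ^+ 2 * q y by apply: hx; left.
  have h2 : q (act (l false) y - y) <= (10%:R^-1 : R) ^+ 2 * q y by apply: hx; right.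
  have qy : 0 < q y := qx.
  by have := hl r y yo; rewrite e2 in h1 h2; lra.
split; last by exists QK, (10%:R^-1).
  have [C cC hC] := core_compact_lift na rG dm dt dc.
  exists ((@core_val G @` QK) `|` C), (10%:R^-1); split.
    by apply: compactU => //; apply: finite_compact; exact: finite_image.
  split=> // H pi upi [x aix].
  have [x0 qx hx] := almost_invariant_q aix.
  pose r := realify_rep na upi; pose y : r := x.
  pose M : set r := fix_by (@finite_index_core G).
  have Ms : subspace M by exact: subspace_fix.
  pose p := oproj M y.
  have qy : 0 < q y := qx.
  have hy g : ((@core_val G @` QK) `|` C) g -> q (act g y - y) <= 100%:R^-1 * q y.
    by rewrite -e2; exact: hx.
  have fp : M p by apply: qclosed_fix; exact: proj_clos.
  have moveK k : act (core_val k) (y - p) - (y - p) = act (core_val k) y - y.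
    by rewrite actB (fp _ (core_valP k)) opprB addrA subrK.
  have qz : q (y - p) <= 12%:R / 100%:R * q y.
    have zo (m : core_rep r) : fix_by setT m -> ip (y - p : core_rep r) m = 0.
      move=> fm; apply: proj_orth => //; apply: sub_clos.
      by move=> k /core_val_onto[k' <-]; exact: fm.
    have := hl (core_rep r) (y - p) zo; rewrite /= => h.
    have h1 : q (act (core_val (l true)) y - y) <= 100%:R^-1 * q y.
      by apply: hy; left; exists (l true) => //; left.
    have h2 : q (act (core_val (l false)) y - y) <= 100%:R^-1 * q y.
      by apply: hy; left; exists (l false) => //; right.
    rewrite -!moveK in h1 h2.
    have {}h : q (y - p) <= 6 * (q (act (core_val (l true)) (y - p) - (y - p)) +
      q (act (core_val (l false)) (y - p) - (y - p))) := h.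
    by lra.
  have qp := q_sub_proj y Ms.
  apply: (@fix_nonzero _ _ r p (100%:R^-1 * q y)) => [g|]; last by rewrite -/p in qp; lra.
  have [c Cc Kcg] := hC g.
  have -> : act g p = act c p by rewrite -[g in LHS](mulVKg c) actM (fp _ Kcg).
  have Mc h m : M m -> M (act h m) by exact: fix_core_act.
  rewrite (act_proj (N := M)) //; try exact: Mc.
  rewrite -projB //; apply: le_trans (q_proj_le _ Ms) _.
  by apply: hy; right.
by exists QK, (10%:R^-1); split=> //; exact: finite_compact.
Qed.
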